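(* Let $\phi=\tilde p/p$ be a bidegree $(m,n)$ rational inner function on $\mathbb{D}^2$. For generic $\alpha\in\mathbb{T}$, let $g_1^\alpha,\dots,g_n^\alpha$ be the parametrizing functions of $\mathcal{C}_\alpha(\phi)$ and let $W_j^\alpha(\zeta)=\left|\frac{\partial\phi}{\partial z_2}(\zeta,g_j^\alpha(\zeta))\right|^{-1}$. Then for all but finitely many (generic) $\alpha\in\mathbb{T}$ the following holds. If $(\tau,\gamma)\in\mathbb{T}^2$ is a singularity of $\phi$ and $\zeta_2=g_j^\alpha(\zeta_1)$ is a branch of $\mathcal{C}_\alpha(\phi)$ going through $(\tau,\gamma)$, i.e. $g_j^\alpha(\tau)=\gamma$, then there are constants $c,C$ such that $$0<c\le\frac{W_j^\alpha(\zeta)}{|\zeta-\tau|^{K_j}}\le C$$ for all $\zeta\neq\tau$ in a neighborhood of $\tau$ in $\mathbb{T}$, where $K_j$ is the contact order of $\phi$ at $(\tau,\gamma)$ associated with the branch $\zeta_2=g_j^\alpha(\zeta_1)$.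
   Context: $\mathbb{D}$ is the open unit disk and $\mathbb{T}$ the unit circle. Rational inner functions. A rational inner function (RIF) on $\mathbb{D}^2$ is a bounded holomorphic rational function on $\mathbb{D}^2$ whose non-tangential boundary values have modulus $1$ almost everywhere on $\mathbb{T}^2$. Here $\phi=\tilde p/p$ where $p\in\mathbb{C}[z_1,z_2]$ has no zeros in $\mathbb{D}^2$, has degree $m$ in $z_1$ and degree $n$ in $z_2$, $\tilde p(z)=z_1^m z_2^n\,\overline{p(1/\bar z_1,1/\bar z_2)}$, and $p,\tilde p$ have no common factor. Then $\phi$ has bidegree $(m,n)$. Standing assumption: $m,n>0$. A singularity of $\phi$ on $\mathbb{T}^2$ is a point where $p=\tilde p=0$; there are finitely many. Level sets. $\mathcal{C}_\alpha(\phi)$ is the closure of $\{\zeta\in\mathbb{T}^2:\lim_{r\to1^-}\phi(r\zeta)=\alpha\}$; it equals $\{\zeta\in\mathbb{T}^2:\tilde p(\zeta)-\alpha p(\zeta)=0\}$. The value $\alpha\in\mathbb{T}$ is exceptional if $\phi(\tau,z_2)\equiv\alpha$ or $\phi(z_1,\tau)\equiv\alpha$ for some $\tau\in\mathbb{T}$; otherwise it is generic. For generic $\alpha$ and any choice of base point $\tau_0\in\mathbb{T}$ there are functions $g_1^\alpha,\dots,g_n^\alpha:\mathbb{T}\to\mathbb{T}$, analytic on $\mathbb{T}\setminus\{\tau_0\}$, such that $\mathcal{C}_\alpha(\phi)=\bigcup_{j=1}^n\{(\zeta,g_j^\alpha(\zeta)):\zeta\in\mathbb{T}\}$. The base point is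 taken not to be the $z_1$-coordinate of a singularity of $\phi$, so that branches through singularities are analytic there. Contact order. Let $(\tau,\gamma)\in\mathbb{T}^2$ be a singularity. Put $\beta(z)=i\frac{1-z}{1+z}$, $\beta^{-1}(z)=\frac{1+iz}{1-iz}$ and $$q(z)=(1-iz_1)^m(1-iz_2)^n\,p(\tau\beta^{-1}(z_1),\gamma\beta^{-1}(z_2)),\quad q^\sharp(z)=(1-iz_1)^m(1-iz_2)^n\,\tilde p(\tau\beta^{-1}(z_1),\gamma\beta^{-1}(z_2)).$$ These are polynomials, and $q$ has no zeros in $\mathbb{H}^2$ ($\mathbb{H}$ = open upper half-plane) and $q(0,0)=0$. It is known that near $(0,0)$ $$q(z)=u(z)\prod_{k=1}^J\prod_{l=1}^{M_k}\left(z_2+q_k(z_1)+z_1^{2L_k}\psi_k\big(\mu_k^l z_1^{1/M_k}\big)\right),$$ where $J,M_k,L_k$ are positive integers, $u$ is analytic with $u(0,0)\ne0$, each $q_k\in\mathbb{R}[z]$ has $\deg q_k<2L_k$, $q_k(0)=0$, $q_k'(0)>0$, $\mu_k=\exp(2\pi i/M_k)$, and each $\psi_k$ is analytic near $0$ with $\mathrm{Im}(\psi_k(0))>0$. Moreover, for all but finitely many $\alpha\in\mathbb{T}$, with the same $q_k,L_k,M_k$, near $(0,0)$ $$q^\sharp(z)-\alpha q(z)=u^\alpha(z)\prod_{k=1}^J\prod_{l=1}^{M_k}\left(z_2+q_k(z_1)+z_1^{2L_k}\psi_{k,l}^\alpha(z_1)\right),$$ where $u^\alpha$ is analytic with $u^\alpha(0,0)\neq0$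 and each $\psi_{k,l}^\alpha$ is real analytic (real-valued on $\mathbb{R}$) near $0$. For such $\alpha$, let $\zeta_2=g_j^\alpha(\zeta_1)$ be a branch with $g_j^\alpha(\tau)=\gamma$, and let $h_j^\alpha(x)=\beta\big(\bar\gamma\,g_j^\alpha(\tau\beta^{-1}(x))\big)$ for real $x$ near $0$. Then $h_j^\alpha(x)=-q_k(x)-x^{2L_k}\psi_{k,l}^\alpha(x)$ for some pair $(k,l)$, and the contact order of $\phi$ at $(\tau,\gamma)$ for this branch is $K_j:=2L_k$. The finitely many $\alpha$ for which the second factorization fails at some singularity are among those excluded in ''all but finitely many''. *)

(* Defs.v *)
(* MathComp / MathComp-Analysis; complex numbers are R[i] for R : realType. *)
From HB Require Import structures.
From mathcomp Require Import all_boot all_order all_algebra.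
From mathcomp Require Import all_classical all_reals all_analysis.
From mathcomp Require Import polyXY complex.
From mathcomp Require Import ring.

Set Implicit Arguments.
Unset Strict Implicit.
Unset Printing Implicit Defensive.

Import Order.TTheory GRing.Theory Num.Theory.
Import numFieldNormedType.Exports.

Local Open Scope classical_set_scope.
Local Open Scope complex_scope.
Local Open Scope ring_scope.

(* The metric topology of R[i], which the libraries give only for abstract
   number fields.  Norms in R[i] are R[i]-valued, and x <= y in R[i] means that
   y - x is real and nonnegative. *)
Set Warnings "-redundant-canonical-projection".
HB.instance Definition _ (R : realType) := NormedModule.copy R[i] R[i]^o.
Set Warnings "redundant-canonical-projection".

Section AnalyticFunctions.
Variable R : realType.
Local Notation C := R[i].

Definition analytic_at (f : C -> C) (a : C) : Prop :=
  exists c : nat -> C, \forall z \near a,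
    (fun N : nat => \sum_(k < N) c k * (z - a) ^+ k) @ \oo --> f z.

(* Near the origin, f is the sum of an absolutely convergent power series in
   two variables. *)
Definition analytic2_at0 (f : C -> C -> C) : Prop :=
  exists c : nat -> nat -> C, \forall z \near ((0, 0) : C * C),
    (exists B : C, forall N : nat,
       \sum_(i < N) \sum_(j < N) `|c i j * z.1 ^+ i * z.2 ^+ j| <= B) /\
    (fun N : nat => \sum_(i < N) \sum_(j < N) c i j * z.1 ^+ i * z.2 ^+ j)
      @ \oo --> f z.1 z.2.

(* Real analyticity on the circle at a: g agrees near a, on the circle, with
   a function analytic in the plane. *)
Definition circle_analytic_at (g : C -> C) (a : C) : Prop :=
  exists2 f : C -> C, analytic_at f a &
    \forall z \near a, `|z| = 1 -> g z = f z.

End AnalyticFunctions.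

Section RationalInnerFunctions.
Variable R : realType.
Local Notation C := R[i].

(* An element p of {poly {poly C}} is a polynomial in (z1, z2) with z1 the outer
   variable: p.[z1, z2] = \sum_i \sum_j p`_i`_j * z1 ^+ i * z2 ^+ j.  Its degree
   in z1 is (size p).-1 and its degree in z2 is (sizeY p).-1. *)
Implicit Types p : {poly {poly C}}.

(* z1^m z2^n conj(p(1/conj z1, 1/conj z2)), see rif_reflectE. *)
Definition rif_reflect (m n : nat) p : {poly {poly C}} :=
  \poly_(i < m.+1) \poly_(j < n.+1) (p`_(m - i)`_(n - j))^*.

Lemma rif_reflectE (m n : nat) p (z1 z2 : C) :
  size p = m.+1 -> sizeY p = n.+1 -> z1 != 0 -> z2 != 0 ->
  (rif_reflect m n p).[z1, z2] =
    z1 ^+ m * z2 ^+ n * (p.[1 / z1^*, 1 / z2^*])^*.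
Proof.
move=> sp sYp z1N0 z2N0.
have hornerYE (r : {poly {poly C}}) (M N : nat) (x y : C) : (size r <= M)%N ->
    (forall i : nat, (size (r`_i)%R <= N)%N) ->
    r.[x, y] = \sum_(i < M) \sum_(j < N) r`_i`_j * y ^+ j * x ^+ i.
  move=> rM rN; rewrite (horner_coef_wide _ rM) horner_sum.
  apply: eq_bigr => i _; rewrite -polyC_exp hornerM hornerC.
  by rewrite (horner_coef_wide _ (rN i)) mulr_suml.
rewrite (@hornerYE _ m.+1 n.+1); last 2 first.
- exact: size_poly.
- move=> i; rewrite coef_poly; case: ifP => _; last by rewrite size_poly0.
  exact: size_poly.
rewrite (@hornerYE p m.+1 n.+1) ?sp //; last first.
  move=> i; rewrite -sYp; have [im|mi] := ltnP i (size p).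
    exact: (leq_bigmax (Ordinal im)).
  by rewrite nth_default ?size_poly0.
rewrite rmorph_sum mulr_sumr (reindex_inj rev_ord_inj) /=.
apply: eq_bigr => i _; rewrite rmorph_sum mulr_sumr (reindex_inj rev_ord_inj) /=.
apply: eq_bigr => j _; rewrite !subSS coef_poly ltnS leq_subr.
rewrite coef_poly ltnS leq_subr !subKn; [|by rewrite -ltnS..].
rewrite !rmorphM !rmorphXn /= !rmorphM !rmorphV ?unitfE ?conjC_eq0 //.
rewrite !rmorph1 /= !conjCK !mul1r !exprVn.
have -> : z1 ^+ m = z1 ^+ (m - i) * z1 ^+ i by rewrite -exprD subnK // -ltnS.
have -> : z2 ^+ n = z2 ^+ (n - j) * z2 ^+ j by rewrite -exprD subnK // -ltnS.
have u1 : z1 ^+ i != 0 by rewrite expf_neq0.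
have u2 : z2 ^+ j != 0 by rewrite expf_neq0.
by field; rewrite u1 u2.
Qed.

(* p is the denominator of a rational inner function of bidegree (m, n). *)
Record rif_denominator (m n : nat) p : Prop := RifDenominator {
  rif_deg1 : size p = m.+1;
  rif_deg2 : sizeY p = n.+1;
  rif_stable : forall z1 z2 : C, `|z1| < 1 -> `|z2| < 1 -> p.[z1, z2] != 0;
  rif_coprime : forall d a b : {poly {poly C}},
    p = d * a -> rif_reflect m n p = d * b -> d \is a GRing.unit }.

Variables (m n : nat) (p : {poly {poly C}}).

Definition rif (z1 z2 : C) : C := (rif_reflect m n p).[z1, z2] / p.[z1, z2].

Definition singularity (tau gamma : C) : Prop :=
  [/\ `|tau| = 1, `|gamma| = 1,
      p.[tau, gamma] = 0 & (rif_reflect m n p).[tau, gamma] = 0].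

Definition level_set (alpha : C) : set (C * C) :=
  closure [set z : C * C | [/\ `|z.1| = 1, `|z.2| = 1 &
    rif (r%:C * z.1) (r%:C * z.2) @[r --> (1 : R)^'-] --> alpha]].

(* Identities of rational functions: tested off the zeros of the denominator. *)
Definition exceptional (alpha : C) : Prop :=
  exists2 tau : C, `|tau| = 1 &
    (forall z2 : C, p.[tau, z2] != 0 -> rif tau z2 = alpha) \/
    (forall z1 : C, p.[z1, tau] != 0 -> rif z1 tau = alpha).

Definition generic (alpha : C) : Prop := `|alpha| = 1 /\ ~ exceptional alpha.

(* The functions T -> T are the restrictions to the circle of the g j. *)
Record level_parametrization (alpha tau0 : C) (g : 'I_n -> C -> C) : Prop :=
  LevelParametrization {
  level_base : `|tau0| = 1;
  level_base_regular : forall tau gamma, singularity tau gamma -> tau0 <> tau;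
  level_circle : forall j zeta, `|zeta| = 1 -> `|g j zeta| = 1;
  level_analytic : forall j zeta, `|zeta| = 1 -> zeta <> tau0 ->
    circle_analytic_at (g j) zeta;
  level_union : level_set alpha =
    \bigcup_(j : 'I_n) [set (zeta, g j zeta) | zeta in [set z : C | `|z| = 1]] }.

Definition weight (gj : C -> C) (zeta : C) : C :=
  `| derive1 (fun z2 => rif zeta z2) (gj zeta) |^-1.

Definition cayley (z : C) : C := 'i * (1 - z) / (1 + z).
Definition cayley_inv (z : C) : C := (1 + 'i * z) / (1 - 'i * z).

(* r in half-plane coordinates centred at (tau, gamma); this is q for r = p and
   q^sharp for r = rif_reflect m n p. *)
Definition halfplane (r : {poly {poly C}}) (tau gamma z1 z2 : C) : C :=
  (1 - 'i * z1) ^+ m * (1 - 'i * z2) ^+ n *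
  r.[tau * cayley_inv z1, gamma * cayley_inv z2].

Definition mu (M : nat) : C :=
  cos (2 * pi / M%:R : R) +i* sin (2 * pi / M%:R : R).

Definition evalR (f : {poly R}) (z : C) : C := (map_poly (real_complex R) f).[z].

(* For every choice s k of an (M k)-th root of z1; the product over l does not
   depend on that choice. *)
Definition local_factorization (q : C -> C -> C) (J : nat)
    (M L : 'I_J -> nat) (f : 'I_J -> {poly R}) : Prop :=
  (0 < J)%N /\
  (forall k, [/\ (0 < M k)%N, (0 < L k)%N, (size (f k) <= 2 * L k)%N,
                 (f k).[0] = 0 & 0 < (deriv (f k)).[0]]) /\
  exists (u : C -> C -> C) (psi : 'I_J -> C -> C),
    [/\ analytic2_at0 u, u 0 0 != 0,
        forall k, analytic_at (psi k) 0 /\ 0 < complex.Im (psi k 0) &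
        \forall z \near ((0, 0) : C * C), forall s : 'I_J -> C,
          (forall k, s k ^+ M k = z.1) ->
          q z.1 z.2 = u z.1 z.2 *
            \prod_(k < J) \prod_(1 <= l < (M k).+1)
              (z.2 + evalR (f k) z.1 +
               z.1 ^+ (2 * L k) * psi k (mu (M k) ^+ l * s k))].

Definition level_factorization (q : C -> C -> C) (J : nat)
    (M L : 'I_J -> nat) (f : 'I_J -> {poly R})
    (psi : 'I_J -> nat -> C -> C) : Prop :=
  exists u : C -> C -> C,
    [/\ analytic2_at0 u, u 0 0 != 0,
        forall k l, (1 <= l <= M k)%N -> analytic_at (psi k l) 0 /\
          \forall x \near (0 : R), psi k l x%:C \is Num.real &
        \forall z \near ((0, 0) : C * C),
          q z.1 z.2 = u z.1 z.2 *
            \prod_(k < J) \prod_(1 <= l < (M k).+1)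
              (z.2 + evalR (f k) z.1 + z.1 ^+ (2 * L k) * psi k l z.1)].

(* K is the contact order at (tau, gamma) associated with the branch
   z2 = gj(z1) of the level set of alpha. *)
Definition contact_order (alpha tau gamma : C) (gj : C -> C) (K : nat) : Prop :=
  exists (J : nat) (M L : 'I_J -> nat) (f : 'I_J -> {poly R})
         (psi : 'I_J -> nat -> C -> C),
    [/\ local_factorization (halfplane p tau gamma) M L f,
        level_factorization
          (fun z1 z2 => halfplane (rif_reflect m n p) tau gamma z1 z2
                        - alpha * halfplane p tau gamma z1 z2) M L f psi &
        exists (k : 'I_J) (l : nat),
          [/\ (1 <= l <= M k)%N,
              \forall x \near (0 : R),
                cayley (gamma^* * gj (tau * cayley_inv x%:C)) =
                - evalR (f k) x%:C - x%:C ^+ (2 * L k) * psi k l x%:C &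
              K = (2 * L k)%N]].

End RationalInnerFunctions.

(* Main.v *)
(* On the torus [p~ = z1^m z2^n conj p], so that off the zeros of [p] the modulus
   of [d phi / d z2] is [|n - 2 Re (z2 p_{z2} / p)|].  In half-plane coordinates
   this is [(1 + w^2) |Im (q_w / q)|] at a real point [(x, w)].  The local
   factorization of [q] gives, up to a bounded error,
     [q_w / q = \sum_k \sum_l 1 / (w + q_k + x^(2 L_k) psi_k)],
   where all terms have a negative imaginary part.  On the branch
   [w = - q_k0 - x^(2 L_k0) psi^alpha] the terms with [k = k0] have an imaginary
   part of size [|x|^(- 2 L_k0)], which gives the upper bound on the weight for
   every [alpha].  Another term can have a larger order only if [L_k > L_k0] and
   the branch agrees with [- q_k] to order larger than [2 L_k0].  In that case
   [phi] tends to [alpha] along the curve [w = - q_k x], which happens for at most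
   one [alpha] for each [q_k].  The [q_k] are determined by [q], and there are
   finitely many singularities by coprimality, hence finitely many exceptions. *)
Require Import Defs.
From mathcomp Require Import all_boot all_order all_algebra.
From mathcomp Require Import all_classical all_reals all_analysis.
From mathcomp Require Import polyXY complex.
From mathcomp Require Import ring lra.

Set Implicit Arguments.
Unset Strict Implicit.
Unset Printing Implicit Defensive.

Import Order.TTheory GRing.Theory Num.Theory.
Import numFieldNormedType.Exports.

Local Open Scope classical_set_scope.
Local Open Scope complex_scope.
Local Open Scope ring_scope.
Import Normc.

(** * Modulus and power series *)

(** The contact order brings its own factorization, quantified after [alpha]. The exceptional set
    must therefore be fixed from all factorizations at once, and uniqueness of the [q_k] is what
    keeps it finite. Analyticity enters only through Lipschitz estimates. Neither [u] nor the [psi]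
    are differentiated: for a frozen real [x] the derivative falls on polynomials in [w], and a
    Lipschitz [u] that is bounded below changes a logarithmic derivative by a bounded amount,
    negligible against [|x|^(-2 L)]. Why [phi] tends to [alpha] along [w = - q_k x]: at real points
    every factor of [q] has modulus at least a constant times [x^(2 L)], by its imaginary part.
    Replacing [psi] by the bounded real [psi^alpha] thus costs at most a constant factor. If the
    branch agrees with the curve to a higher order, one factor of [q^sharp - alpha q] gains a power
    of [x], so the quotient by [q] is [O(x)]. *)

Section ComplexModulus.
Variable R : realType.
Local Notation C := R[i].
Implicit Types (x y : R) (z w : C).

Lemma normrE z : `|z| = (normc z)%:C.
Proof. by []. Qed.

Lemma normc_ge0 z : 0 <= normc z.
Proof. by rewrite -ler0c -normrE. Qed.

Lemma normc_gt0 z : z != 0 -> 0 < normc z.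
Proof. by move=> z0; rewrite -ltcR -normrE normr_gt0. Qed.

Lemma normc_eq0 z : (normc z == 0) = (z == 0).
Proof.
by rewrite -(normr_eq0 z) normrE -[0 in RHS]/(0%:C) (inj_eq (@complexI R)).
Qed.

Lemma normc_real x : normc x%:C = `|x|.
Proof. by rewrite /= expr0n /= addr0 sqrtr_sqr. Qed.

Lemma normcX z n : normc (z ^+ n) = normc z ^+ n.
Proof.
by apply: (@complexI R); rewrite rmorphXn /= -normrE normrX normrE.
Qed.

Lemma normcB z w : normc (z - w) <= normc z + normc w.
Proof. by rewrite -(normcN w) le_normcD. Qed.

Lemma normcC z w : normc (z - w) = normc (w - z).
Proof. by rewrite -normcN opprB. Qed.

Lemma normc_dist z w : `|normc z - normc w| <= normc (z - w).
Proof.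
have h := le_normcD (z - w) w; have h' := le_normcD (w - z) z.
rewrite !subrK in h h'; rewrite (normcC w) in h'.
by rewrite ler_norml; apply/andP; split; lra.
Qed.

Lemma normc_conj z : normc z^* = normc z.
Proof. by apply: (@complexI R); rewrite -!normrE normcJ. Qed.

Lemma normc_Re z : `|complex.Re z| <= normc z.
Proof. by rewrite -lecR -normrE normc_ge_Re. Qed.

Lemma normc_Im z : `|complex.Im z| <= normc z.
Proof.
case: z => a b /=.
by rewrite -{1}(sqrtr_sqr b) ler_wsqrtr // lerDr sqr_ge0.
Qed.

Lemma ReD z w : complex.Re (z + w) = complex.Re z + complex.Re w.
Proof. by case: z; case: w. Qed.

Lemma ImD z w : complex.Im (z + w) = complex.Im z + complex.Im w.
Proof. by case: z; case: w. Qed.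

Lemma ReN z : complex.Re (- z) = - complex.Re z.
Proof. by case: z. Qed.

Lemma ImN z : complex.Im (- z) = - complex.Im z.
Proof. by case: z. Qed.

Lemma Re_realM x z : complex.Re (x%:C * z) = x * complex.Re z.
Proof. by case: z => a b /=; rewrite mul0r subr0. Qed.

Lemma Im_realM x z : complex.Im (x%:C * z) = x * complex.Im z.
Proof. by case: z => a b /=; rewrite mul0r addr0. Qed.

Lemma Re_iM z : complex.Re ('i * z) = - complex.Im z.
Proof. by rewrite mulrC -complexiE ReiNIm. Qed.

Lemma Im_iM z : complex.Im ('i * z) = complex.Re z.
Proof. by rewrite mulrC -complexiE ImiRe. Qed.

Lemma normc_sqr z : normc z ^+ 2 = complex.Re z ^+ 2 + complex.Im z ^+ 2.
Proof. by case: z => a b /=; rewrite sqr_sqrtr // addr_ge0 ?sqr_ge0. Qed.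

Lemma normc_sum I (r : seq I) (P : pred I) (F : I -> C) :
  normc (\sum_(i <- r | P i) F i) <= \sum_(i <- r | P i) normc (F i).
Proof.
rewrite -lecR -normrE rmorph_sum; apply: le_trans (ler_norm_sum _ _ _) _.
by rewrite le_eqVlt; apply/orP; left; apply/eqP/eq_bigr.
Qed.

Lemma normc_prod I (r : seq I) (P : pred I) (F : I -> C) :
  normc (\prod_(i <- r | P i) F i) = \prod_(i <- r | P i) normc (F i).
Proof. exact: (big_morph (@normc R) (@normcM R) (normc1 R)). Qed.

Lemma near_cplx (a : C) (P : set C) :
  (\forall z \near a, P z) <->
  exists2 r : R, 0 < r & forall z, normc (z - a) < r -> P z.
Proof.
split=> [/nbhs_normP[e /= e0 eP]|[r r0 rP]].
  have eE : e = (complex.Re e)%:C by rewrite RRe_real ?gtr0_real.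
  exists (complex.Re e) => [|z zr]; first by rewrite -ltcR -eE.
  by apply: eP; rewrite /ball_ /= normrE eE ltcR normcC.
apply/nbhs_normP; exists r%:C => /=; first by rewrite ltcR.
by move=> z; rewrite /ball_ /= normrE ltcR => zr; apply: rP; rewrite normcC.
Qed.

Lemma near_cplx2 (P : set (C * C)) : (\forall z \near ((0, 0) : C * C), P z) ->
  exists2 r : R, 0 < r & forall z w, normc z < r -> normc w < r -> P (z, w).
Proof.
case=> -[/= A B] [/near_cplx[r r0 rA] /near_cplx[s s0 sB]] AB.
exists (Num.min r s) => [|z w]; first by rewrite lt_min r0.
rewrite !lt_min => /andP[zr _] /andP[_ ws]; apply: AB; split => /=.
  by apply: rA; rewrite subr0.
by apply: sB; rewrite subr0.
Qed.

Lemma near_real0 (P : set R) : (\forall x \near (0 : R), P x) <->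
  exists2 r : R, 0 < r & forall x, `|x| < r -> P x.
Proof.
split=> [/nbhs_normP[r /= r0 rP]|[r r0 rP]].
  by exists r => // x xr; apply: rP; rewrite /ball_ /= sub0r normrN.
apply/nbhs_normP; exists r => //= x; rewrite /ball_ /= sub0r normrN.
exact: rP.
Qed.

Lemma cvg_cplx (u : nat -> C) (l : C) : u @ \oo --> l ->
  forall e : R, 0 < e -> exists N, forall k, (N <= k)%N -> normc (u k - l) < e.
Proof.
move=> ul e e0; have eC : 0 < e%:C by rewrite ltcR.
have [N _ NP] := (@cvgrPdist_lt _ _ _ _ _ u l).1 ul _ eC.
by exists N => k Nk; have := NP k Nk; rewrite /= normrE ltcR normcC.
Qed.

Lemma le_eps (a b : R) : (forall e, 0 < e -> a <= b + e) -> a <= b.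
Proof. by move/ler_addgt0Pr. Qed.

Lemma le_normc_lim2 (u v : nat -> C) (k l : C) (b : R) :
  u @ \oo --> k -> v @ \oo --> l ->
  (forall N, normc (u N - v N) <= b) -> normc (k - l) <= b.
Proof.
move=> uk vl uvb; apply: le_eps => e e0.
have e2 : 0 < e / 2 by rewrite divr_gt0.
have [N1 /(_ (maxn N1 _) (leq_maxl _ _)) h1] := cvg_cplx uk e2.
have [N2 /(_ (maxn _ N2) (leq_maxr _ _)) h2] := cvg_cplx vl e2.
set N := maxn N1 N2.
have -> : k - l = (u N - v N) - (u N - k) + (v N - l) by ring.
have := le_normcD ((u N - v N) - (u N - k)) (v N - l).
have := normcB (u N - v N) (u N - k); have := uvb N.
have := h1 N2; have := h2 N1; rewrite -/N; lra.
Qed.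

End ComplexModulus.

Section PowerSeries.
Variable R : realType.
Local Notation C := R[i].

(** Halving the radius absorbs the factor [j] of the derivative of a power: in the induction both
    summands are at most [r ^+ j * normc (z - w)]. *)
Lemma normc_expB (r : R) (z w : C) j : 0 < r ->
  normc z <= r / 2 -> normc w <= r / 2 ->
  normc (z ^+ j - w ^+ j) <= 2 / r * r ^+ j * normc (z - w).
Proof.
move=> r0 zr wr; elim: j => [|j IH].
  by rewrite subrr normc0 expr0 !mulr_ge0 ?invr_ge0 ?normc_ge0 ?ltW.
have -> : z ^+ j.+1 - w ^+ j.+1 = z * (z ^+ j - w ^+ j) + (z - w) * w ^+ j.
  by rewrite !exprS; ring.
apply: le_trans (le_normcD _ _) _; rewrite !normcM normcX.
have wj : normc w ^+ j <= r ^+ j.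
  rewrite lerXn2r ?nnegrE ?normc_ge0 ?ltW //.
  by apply: le_lt_trans wr _; rewrite ltr_pdivrMr // ltr_pMr // ltr1n.
rewrite [leRHS](_ : _ = r / 2 * (2 / r * r ^+ j * normc (z - w)) +
                        normc (z - w) * r ^+ j); last first.
  by rewrite exprS; field; rewrite gt_eqF.
by rewrite lerD ?ler_wpM2l ?ler_pM ?normc_ge0.
Qed.

Lemma normc_monomB (r : R) (z w z' w' : C) i j : 0 < r ->
  normc z <= r / 2 -> normc w <= r / 2 ->
  normc z' <= r / 2 -> normc w' <= r / 2 ->
  normc (z ^+ i * w ^+ j - z' ^+ i * w' ^+ j) <=
  2 / r * (r ^+ i * r ^+ j) * (normc (z - z') + normc (w - w')).
Proof.
move=> r0 zr wr z'r w'r.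
have hr : r / 2 <= r by rewrite ler_pdivrMr // ler_peMr ?ler1n ?ltW.
have -> : z ^+ i * w ^+ j - z' ^+ i * w' ^+ j =
  z ^+ i * (w ^+ j - w' ^+ j) + (z ^+ i - z' ^+ i) * w' ^+ j by ring.
apply: le_trans (le_normcD _ _) _; rewrite !normcM !normcX.
rewrite [leRHS](_ : _ = r ^+ i * (2 / r * r ^+ j * normc (w - w')) +
  (2 / r * r ^+ i * normc (z - z')) * r ^+ j); last by ring.
rewrite lerD // ler_pM ?exprn_ge0 ?normc_ge0 ?normc_expB //.
  by rewrite lerXn2r ?nnegrE ?normc_ge0 ?(ltW r0) // (le_trans zr).
by rewrite lerXn2r ?nnegrE ?normc_ge0 ?(ltW r0) // (le_trans w'r).
Qed.

(** Absolute convergence at the single point [(r, r)] controls the Lipschitz constants of all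
    monomials, so the partial sums have a common constant, which passes to the limit. *)
Lemma analytic2_lipschitz (u : C -> C -> C) : analytic2_at0 u ->
  exists r L : R, [/\ 0 < r, 0 < L & forall z w z' w',
    normc z < r -> normc w < r -> normc z' < r -> normc w' < r ->
    normc (u z w - u z' w') <= L * (normc (z - z') + normc (w - w'))].
Proof.
move=> [c /near_cplx2[r0 r0_gt0 cP]].
pose r : R := r0 / 2.
have r_gt0 : 0 < r by rewrite divr_gt0.
have rr0 : r < r0 by rewrite ltr_pdivrMr // ltr_pMr // ltr1n.
have r_norm : normc r%:C = r by rewrite normc_real ger0_norm // ltW.
have [||[B BP] _] := cP r%:C r%:C; rewrite ?r_norm //.
have [b bB] : exists b : R, forall N,
    \sum_(i < N) \sum_(j < N) normc (c i j) * (r ^+ i * r ^+ j) <= b.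
  exists (complex.Re B) => N; have := BP N; rewrite lecE => /andP[_].
  apply: le_trans; rewrite raddf_sum; apply: ler_sum => i _.
  rewrite raddf_sum; apply: ler_sum => j _.
  rewrite [leRHS](_ : _ = normc (c i j * r%:C ^+ i * r%:C ^+ j)) //.
  by rewrite !normcM !normcX r_norm mulrA.
have b0 : 0 <= b by have := bB 0; rewrite big_ord0.
exists (r / 2), (2 / r * (b + 1)); split.
- by rewrite divr_gt0.
- by rewrite mulr_gt0 ?divr_gt0 // ltr_wpDl.
move=> z w z' w' zr wr z'r w'r.
have r2r0 : r / 2 < r0.
  by apply: le_lt_trans rr0; rewrite ler_pdivrMr // ler_peMr ?ler1n ?ltW.
have [||_ lim1] := cP z w; [exact: lt_trans r2r0..|].
have [||_ lim2] := cP z' w'; [exact: lt_trans r2r0..|].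
apply: (le_normc_lim2 lim1 lim2) => N /=.
rewrite -sumrB; under eq_bigr do rewrite -sumrB.
apply: le_trans (normc_sum _ _ _) _.
have D0 : 0 <= normc (z - z') + normc (w - w') by rewrite addr_ge0 ?normc_ge0.
apply: (@le_trans _ _ (2 / r * b * (normc (z - z') + normc (w - w')))); last first.
  by rewrite ler_wpM2r // ler_wpM2l ?lerDl // divr_ge0 // ltW.
apply: le_trans (_ : 2 / r *
   (\sum_(i < N) \sum_(j < N) normc (c i j) * (r ^+ i * r ^+ j)) *
   (normc (z - z') + normc (w - w')) <= _); last first.
  by rewrite ler_wpM2r // ler_wpM2l ?bB // divr_ge0 // ltW.
rewrite mulr_sumr mulr_suml; apply: ler_sum => i _.
apply: le_trans (normc_sum _ _ _) _.
rewrite mulr_sumr mulr_suml; apply: ler_sum => j _.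
rewrite -!(mulrA (c i j)) -mulrBr normcM.
rewrite [leRHS](_ : _ = normc (c i j) *
  (2 / r * (r ^+ i * r ^+ j) * (normc (z - z') + normc (w - w')))); last by ring.
by rewrite ler_wpM2l ?normc_ge0 // normc_monomB // ltW.
Qed.

(** Convergence at [a + r] bounds the terms [c k * r ^+ k]; on half that radius the differences are
    dominated by a geometric series of ratio [1/2]. *)
Lemma analytic_lipschitz (f : C -> C) (a : C) : analytic_at f a ->
  exists r L : R, [/\ 0 < r, 0 < L & forall z,
    normc (z - a) < r -> normc (f z - f a) <= L * normc (z - a)].
Proof.
move=> [c /near_cplx[r0 r0_gt0 cP]].
pose r : R := r0 / 2.
have r_gt0 : 0 < r by rewrite divr_gt0.
have rr0 : r < r0 by rewrite ltr_pdivrMr // ltr_pMr // ltr1n.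
have r_norm : normc r%:C = r by rewrite normc_real ger0_norm // ltW.
have [b b0 bP] : exists2 b : R, 0 < b & forall k, normc (c k) * r ^+ k <= b.
  have {}/cP limr : normc ((a + r%:C) - a) < r0 by rewrite addrC addKr r_norm.
  have [N NP] := cvg_cplx limr ltr01.
  have t0 i : 0 <= normc (c i) * r ^+ i.
    by rewrite mulr_ge0 ?normc_ge0 ?exprn_ge0 ?ltW.
  exists (\sum_(k < N) normc (c k) * r ^+ k + 2).
    by rewrite ltr_wpDl // sumr_ge0.
  (* A late term is the difference of two partial sums within 1 of the limit, hence at most 2; the
     earlier terms are covered by the sum in the witness. *)
  move=> k; have [kN|Nk] := ltnP k N.
    by rewrite (bigD1 (Ordinal kN)) //= -addrA lerDl addr_ge0 ?sumr_ge0.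
  apply: (@le_trans _ _ 2); last by rewrite lerDr sumr_ge0.
  have h1 := NP k Nk; have h2 := NP k.+1 (leqW Nk).
  rewrite big_ord_recr /= (_ : a + r%:C - a = r%:C) in h1 h2; last by ring.
  set S := \sum_(i < k) _ in h1 h2; set l := f _ in h1 h2.
  have e (s t v : C) : s + t - v - (s - v) = t by ring.
  have := normcB (S + c k * r%:C ^+ k - l) (S - l).
  by rewrite e normcM normcX r_norm; lra.
exists (r / 2), (4 * b / r).
split; [exact: divr_gt0|by rewrite divr_gt0 ?mulr_gt0|].
move=> z zr.
have r2r0 : r / 2 < r0.
  by apply: le_lt_trans rr0; rewrite ler_pdivrMr // ler_peMr ?ler1n ?ltW.
have lim1 := cP z (lt_trans zr r2r0).
have /cP lim2 : normc (a - a) < r0 by rewrite subrr normc0.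
apply: (le_normc_lim2 lim1 lim2) => N.
rewrite -sumrB; apply: le_trans (normc_sum _ _ _) _.
have step k : normc (c k * (z - a) ^+ k - c k * (a - a) ^+ k) <=
    2 * b / r * normc (z - a) * 2^-1 ^+ k.
  case: k => [|k].
    by rewrite !expr0 subrr normc0 !mulr_ge0 ?normc_ge0 ?invr_ge0 ?ltW.
  rewrite subrr expr0n /= mulr0 subr0 normcM normcX.
  rewrite [leLHS](_ : _ =
      (normc (c k.+1) * r ^+ k.+1) * (normc (z - a) / r) ^+ k.+1); last first.
    by rewrite -mulrA -exprMn mulrCA divff ?mulr1 ?gt_eqF.
  rewrite [leRHS](_ : _ = b * (normc (z - a) / r * 2^-1 ^+ k)); last first.
    by rewrite exprS; field; rewrite gt_eqF.
  have zr0 : 0 <= normc (z - a) / r by rewrite divr_ge0 ?normc_ge0 ?ltW.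
  apply: ler_pM => //; [|exact: exprn_ge0|].
    by rewrite mulr_ge0 ?normc_ge0 ?exprn_ge0 ?ltW.
  rewrite exprS.
  apply: ler_wpM2l => //; rewrite lerXn2r ?nnegrE ?invr_ge0 //.
  by rewrite ler_pdivrMr // mulrC ltW.
apply: le_trans (ler_sum _ (fun (k : 'I_N) _ => step k)) _.
rewrite -mulr_sumr [leRHS](_ : _ = 2 * b / r * normc (z - a) * 2); last by ring.
rewrite ler_wpM2l ?mulr_ge0 ?normc_ge0 ?invr_ge0 ?(ltW b0) ?(ltW r_gt0) //.
have e : \sum_(k < N) 2^-1 ^+ k + 2 * 2^-1 ^+ N = 2 :> R.
  elim: N => [|N IH]; first by rewrite big_ord0 expr0; lra.
  by rewrite big_ord_recr /= exprS -[RHS]IH; field.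
by rewrite -[leRHS]e lerDl mulr_ge0 ?exprn_ge0 ?invr_ge0.
Qed.

End PowerSeries.

(** * Finiteness of the singularities *)

Section CommonZeros.
Variable F : closedFieldType.
Implicit Types (p t g a : {poly {poly F}}) (c d : {poly F}).

Lemma map_horner_eval_eq0 (y : F) p :
  map_poly (horner_eval y) p = 0 -> exists s, p = ('X - y%:P) *: s.
Proof.
move=> p0; exists (map_poly (fun q => q %/ ('X - y%:P)) p).
apply/polyP => i; rewrite coefZ coef_map_id0 ?div0p // mulrC divpK //.
rewrite -[_ %| _]/(_ %| p`_i) dvdp_XsubCl /root.
by have /polyP/(_ i) := p0; rewrite coef_map coef0 /= /horner_eval => ->.
Qed.

(* Gauss's lemma: the scalar [c] is removed from [g * a] one root at a time. *)
Lemma gauss_factor c p g a : c != 0 -> c *: p = g * a ->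
  exists g' a' e, p = g' * a' /\ g = e *: g'.
Proof.
elim: {c}(size c) {-2}c (leqnn (size c)) p g a => [|N IH] c.
  by rewrite leqn0 size_poly_eq0 => /eqP ->; rewrite eqxx.
move=> cN p g a c0 cp; have [c1|c1] := leqP (size c) 1.
  have [k k0 cE] : exists2 k, k != 0 & c = k%:P.
    by exists c`_0; [rewrite -polyC_eq0|]; rewrite -size1_polyC.
  exists g, (k^-1%:P *: a), 1; split; last by rewrite scale1r.
  by rewrite -scalerAr -cp scalerA cE -polyCM mulVf // scale1r.
have [y /factor_theorem[c' cE]] : exists y, root c y.
  by apply/closed_rootP; rewrite neq_ltn c1 orbT.
have d0 : 'X - y%:P != 0 :> {poly F} by rewrite polyXsubC_eq0.
have d0P : ('X - y%:P)%:P != 0 :> {poly {poly F}} by rewrite polyC_eq0.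
have c'0 : c' != 0 by apply: contra_neq c0 => c'0; rewrite cE c'0 mul0r.
have c'N : (size c' <= N)%N.
  by move: cN; rewrite cE size_Mmonic ?monicXsubC // size_XsubC addn2.
have : map_poly (horner_eval y) g * map_poly (horner_eval y) a = 0.
  rewrite -rmorphM /= -cp map_polyZ /= /horner_eval cE hornerM hornerXsubC.
  by rewrite subrr mulr0 scale0r.
move/eqP; rewrite mulf_eq0 => /orP[] /eqP/map_horner_eval_eq0[s sE].
  have /(IH _ c'N)[//|g' [a' [e [pE se]]]] : c' *: p = s * a.
    apply: (mulfI d0P); rewrite !mul_polyC scalerA scalerAl -sE -cp cE.
    by rewrite (mulrC c').
  by exists g', a', (('X - y%:P) * e); rewrite sE se scalerA.
have /(IH _ c'N)[//|g' [a' [e [pE se]]]] : c' *: p = g * s.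
  apply: (mulfI d0P); rewrite !mul_polyC scalerA scalerAr -sE -cp cE.
  by rewrite (mulrC c').
by exists g', a', e.
Qed.

(** Pseudo-division gives the gcd only up to scalars of [{poly F}]. Gauss's lemma turns it into a
    true common factor, a unit by hypothesis, so the gcd is constant in the outer variable. Bezout
    then yields a nonzero element of [{poly F}] that vanishes at the second coordinate of every
    common zero. *)
Lemma coprime_common_zeros p t : p != 0 ->
  (forall d a b : {poly {poly F}}, p = d * a -> t = d * b -> d \is a GRing.unit) ->
  exists2 c, c != 0 & forall x y, p.[x, y] = 0 -> t.[x, y] = 0 -> root c y.
Proof.
move=> p0 cop; have : coprimep p t.
  rewrite coprimep_def; set g := gcdp p t.
  have g0 : g != 0 by rewrite gcdp_eq0 negb_and p0.
  have /Pdiv.Idomain.dvdpP[[c a] /= c0 cp] : g %| p by exact: dvdp_gcdl.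
  have /Pdiv.Idomain.dvdpP[[c' b] /= c'0 ct] : g %| t by exact: dvdp_gcdr.
  rewrite mulrC in cp; have [g1 [a1 [e1 [pE gE]]]] := gauss_factor c0 cp.
  rewrite gE -scalerAr mulrC scalerAr in ct.
  have [g2 [a2 [e2 [tE g1E]]]] := gauss_factor c'0 ct.
  have : g2 \is a GRing.unit.
    by apply: (cop _ (e2 *: a1) a2) => //; rewrite pE g1E -scalerAl scalerAr.
  rewrite poly_unitE => /andP[/eqP g2s _].
  by move: g0; rewrite gE g1E !scalerA -mul_polyC mulf_eq0 polyC_eq0 => /norP[e0 _];
    rewrite mul_polyC size_scale ?g2s.
case/Bezout_coprimepP => u /eqpP[[c1 c2] /= /andP[_ c20] ucE].
exists c2 => // x y px tx; apply/rootP.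
have := congr1 (fun q => q.[x, y]) ucE => /=.
by rewrite !(hornerZ, hornerD, hornerM) px tx !mulr0 addr0 mulr0 !hornerC mulr1.
Qed.

Lemma finite_roots (q : {poly F}) : q != 0 -> finite_set [set z | root q z].
Proof.
move=> q0; have [rs qE] := closed_field_poly_normal q.
apply: (sub_finite_set _ (finite_seq rs)) => z /=.
by rewrite qE rootZ ?lead_coef_eq0 // root_prod_XsubC.
Qed.

End CommonZeros.

Section Reflection.
Variable R : realType.
Local Notation C := R[i].

Lemma conj_unit (z : C) : `|z| = 1 -> z^* = z^-1.
Proof. by move=> z1; rewrite invC_norm z1 expr1n invr1 mul1r. Qed.

(** The one-variable reflection [z^n conj(r(1/conj z))] for a formal degree [n], which may exceed
    the degree of [r] since slices of [p] can drop degree. *)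
Definition conj_rev (n : nat) (r : {poly C}) : {poly C} :=
  \poly_(j < n.+1) (r`_(n - j))^*.

Lemma horner_conj_rev n (r : {poly C}) (z : C) : (size r <= n.+1)%N ->
  `|z| = 1 -> (conj_rev n r).[z] = z ^+ n * (r.[z])^*.
Proof.
move=> rn z1; rewrite horner_poly (horner_coef_wide _ rn) rmorph_sum mulr_sumr.
have z0 : z != 0 by rewrite -normr_eq0 z1 oner_eq0.
rewrite (reindex_inj rev_ord_inj) /=; apply: eq_bigr => j _.
have jn : (j <= n)%N by rewrite -ltnS.
rewrite subSS subKn // rmorphM rmorphXn /= (conj_unit z1) exprVn mulrCA.
by rewrite exprB ?unitfE.
Qed.

Lemma rif_reflect_coef m n (p : {poly {poly C}}) i : (i <= m)%N ->
  (rif_reflect m n p)`_i = conj_rev n p`_(m - i).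
Proof. by move=> im; rewrite coef_poly ltnS im. Qed.

End Reflection.

Section Singularities.
Variable R : realType.
Local Notation C := R[i].
Variables (m n : nat) (p : {poly {poly C}}).
Hypothesis hp : rif_denominator m n p.

Lemma size_coef_den i : (size (p`_i)%R <= n.+1)%N.
Proof. by rewrite -(rif_deg2 hp) max_size_coefXY. Qed.

(** If [p] vanished on the line [z2 = y], so would its reflection, because reflection fixes the
    points of the circle; [z2 - y] would be a common factor. *)
Lemma map_horner_den_neq0 (y : C) : `|y| = 1 -> map_poly (horner_eval y) p != 0.
Proof.
move=> y1; apply/eqP => p0.
have [a pE] := map_horner_eval_eq0 p0.
have [b tE] : exists b, rif_reflect m n p = ('X - y%:P) *: b.
  apply: map_horner_eval_eq0; apply/polyP => i; rewrite coef_map coef0.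
  have [im|mi] := leqP i m; last first.
    by rewrite nth_default ?raddf0 // (leq_trans (size_poly _ _)).
  rewrite rif_reflect_coef //= /horner_eval horner_conj_rev ?size_coef_den //.
  have /polyP/(_ (m - i)%N) := p0; rewrite coef_map coef0 /= /horner_eval => ->.
  by rewrite rmorph0 mulr0.
have := @rif_coprime _ _ _ _ hp ('X - y%:P)%:P a b.
rewrite -!mul_polyC in pE tE; move=> /(_ pE tE).
by rewrite poly_unitE coefC /= poly_unitE size_XsubC andbF.
Qed.

(** The second coordinates are roots of the Bezout element [c], and above each such [y] the slice of
    [p] is a nonzero polynomial in [z1]. *)
Lemma finite_singularities :
  finite_set [set z : C * C | singularity m n p z.1 z.2].
Proof.
have p0 : p != 0 by rewrite -size_poly_eq0 (rif_deg1 hp).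
have [c c0 cP] := coprime_common_zeros p0 (@rif_coprime _ _ _ _ hp).
have fin : finite_set (\bigcup_(y in [set y | root c y /\ `|y| = 1])
    [set (x, y) | x in [set x | root (map_poly (horner_eval y) p) x]]).
  apply: bigcup_finite => [|y [_ y1]].
    by apply: sub_finite_set (finite_roots c0) => y [].
  by apply: finite_image; apply: finite_roots; apply: map_horner_den_neq0.
apply: sub_finite_set fin => -[x y] /= [_ y1 px tx].
exists y; first by split=> //; exact: cP px tx.
exists x => //=; apply/rootP.
have xE : x = horner_eval y x%:P by rewrite /horner_eval hornerC.
by rewrite {1}xE horner_map.
Qed.

End Singularities.

(** * The derivative of a rational inner function on the torus *)

Section DerivePoly.
Variable K : numFieldType.

Lemma derivable_horner_num (q : {poly K}) (x : K) : derivable (horner q) x 1.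
Proof.
elim/poly_ind: q => [|q c IH].
  rewrite (_ : horner 0 = cst 0); last by apply/funext => y; rewrite horner0.
  exact: derivable_cst.
rewrite (_ : horner _ = (fun y => q.[y] * y) + cst c); last first.
  by apply/funext => y; rewrite !hornerE.
apply: derivableD; last exact: derivable_cst.
by apply: derivableM; [exact: IH|exact: derivable_id].
Qed.

Lemma derive_horner_num (q : {poly K}) (x : K) :
  'D_1 (horner q) x = (q^`()%R).[x].
Proof.
elim/poly_ind: q => [|q c IH].
  rewrite (_ : horner 0 = cst 0); last by apply/funext => y; rewrite horner0.
  by rewrite derive_cst deriv0 horner0.
rewrite (_ : horner _ = (fun y => q.[y] * y) + cst c); last first.
  by apply/funext => y; rewrite !hornerE.
have dq := @derivable_horner_num q x.
have did : derivable (id : K -> K) x 1 by exact: derivable_id.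
rewrite deriveD; [|by apply: derivableM|exact: derivable_cst].
rewrite derive_cst addr0 (deriveM dq did) IH derive_id.
rewrite derivD derivM derivX derivC addr0 mulr1 !hornerE.
by rewrite /GRing.scale /= mulr1 mulrC addrC.
Qed.

Lemma derive1_horner_div (q r : {poly K}) (x : K) : r.[x] != 0 ->
  derive1 (fun z => q.[z] / r.[z]) x =
  ((q^`()%R).[x] * r.[x] - q.[x] * (r^`()%R).[x]) / r.[x] ^+ 2.
Proof.
move=> rx; have dq := @derivable_horner_num q x.
have dr := @derivable_horner_num r x.
have drV := derivableV rx dr.
rewrite derive1E (deriveM dq drV) (deriveV rx dr) !derive_horner_num.
by rewrite /GRing.scale /=; field.
Qed.

End DerivePoly.

Section Weight.
Variable R : realType.
Local Notation C := R[i].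

(** The slice of the reflection is a unimodular multiple of the reflection of the slice, which makes
    the derivative in [z2] a one-variable question. *)
Lemma horner_rif_reflect m n (p : {poly {poly C}}) (z : C) :
  (size p <= m.+1)%N -> (forall i, (size (p`_i)%R <= n.+1)%N) -> `|z| = 1 ->
  (rif_reflect m n p).[z%:P] = z ^+ m *: conj_rev n p.[z%:P].
Proof.
move=> pm pn z1; have z0 : z != 0 by rewrite -normr_eq0 z1 oner_eq0.
apply/polyP => j; rewrite coefZ coef_poly.
rewrite horner_poly (horner_coef_wide _ pm) !coef_sum.
have [jn|nj] := ltnP j n.+1; last first.
  rewrite mulr0 big1 // => i _; rewrite -rmorphXn mulrC mul_polyC coefZ.
  by rewrite coef_poly ltnNge nj /= mulr0.
rewrite rmorph_sum mulr_sumr (reindex_inj rev_ord_inj) /=.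
apply: eq_bigr => i _; have im : (i <= m)%N by rewrite -ltnS.
rewrite -!rmorphXn !(mulrC _ (polyC _)) !mul_polyC !coefZ coef_poly jn.
rewrite subSS subKn // rmorphM rmorphXn /= (conj_unit z1) exprVn mulrA.
by rewrite exprB ?unitfE.
Qed.

(** Reversing the coefficients replaces the index [j] by [n - j], so the Euler operator [z d/dz]
    becomes [n] minus its conjugate. *)
Lemma deriv_conj_rev n (r : {poly C}) (z : C) : (size r <= n.+1)%N ->
  `|z| = 1 ->
  z * ((conj_rev n r)^`()%R).[z] =
  n%:R * (conj_rev n r).[z] - z ^+ n * (z * (r^`()%R).[z])^*.
Proof.
move=> rn z1; have z0 : z != 0 by rewrite -normr_eq0 z1 oner_eq0.
have zderiv (s : {poly C}) : (size s <= n.+1)%N ->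
    z * (s^`()%R).[z] = \sum_(j < n.+1) j%:R * (s`_j * z ^+ j).
  move=> sn; have sn' : (size (s^`()%R) <= n)%N.
    by apply: leq_trans (size_poly _ _) _; rewrite -subn1 leq_subLR.
  rewrite (horner_coef_wide _ sn') mulr_sumr big_ord_recl mul0r add0r.
  apply: eq_bigr => j _; rewrite lift0 coef_deriv exprS.
  by rewrite -mulr_natl; ring.
rewrite !zderiv ?size_poly // horner_poly mulr_sumr rmorph_sum mulr_sumr.
rewrite (reindex_inj rev_ord_inj) /=.
rewrite [X in X - _](reindex_inj rev_ord_inj) /= -sumrB.
apply: eq_bigr => j _; have jn : (j <= n)%N by rewrite -ltnS.
rewrite !subSS coef_poly ltnS leq_subr !subKn //.
rewrite !rmorphM rmorphXn /= (conj_unit z1) exprVn rmorph_nat.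
by rewrite exprB ?unitfE // natrB //; field; rewrite expf_neq0.
Qed.

Lemma size_horner_outer n (p : {poly {poly C}}) (z : C) :
  (forall i, (size (p`_i)%R <= n)%N) -> (size (p.[z%:P])%R <= n)%N.
Proof.
move=> pn; rewrite horner_coef; apply: leq_trans (size_sum _ _ _) _.
apply/bigmax_leqP => i _.
by rewrite -rmorphXn mulrC mul_polyC (leq_trans (size_scale_leq _ _)).
Qed.

Lemma normc_deriv_rif m n (p : {poly {poly C}}) (z w : C) :
  (size p <= m.+1)%N -> (forall i, (size (p`_i)%R <= n.+1)%N) ->
  `|z| = 1 -> `|w| = 1 -> p.[z, w] != 0 ->
  normc (derive1 (fun z2 => rif m n p z z2) w) =
  `|n%:R - 2 * complex.Re (w * (p.[z%:P]^`()%R).[w] / p.[z, w])|.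
Proof.
move=> pm pn z1 w1 pw; set r := p.[z%:P].
have rn : (size r <= n.+1)%N by exact: size_horner_outer.
rewrite /rif horner_rif_reflect // (@derive1_horner_div R[i]) // -/r.
have w0 : w != 0 by rewrite -normr_eq0 w1 oner_eq0.
have rw : r.[w] != 0 by [].
rewrite derivZ !hornerZ.
have wD := deriv_conj_rev rn w1; rewrite horner_conj_rev // in wD *.
set D := (_^`()).[w] in wD *.
have -> : D = w^-1 * (n%:R * (w ^+ n * (r.[w])^*) - w ^+ n * (w * (r^`()%R).[w])^*).
  by rewrite -wD mulKf.
set t := w * _ / _.
have -> : (r^`()%R).[w] = w^-1 * (t * r.[w]).
  by rewrite /t divfK // mulKf.
rewrite (mulrA w) divff // mul1r rmorphM /=.
rewrite [X in normc X](_ : _ = z ^+ m * w ^+ n * w^-1 * ((r.[w])^* / r.[w]) *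
   (n%:R - (t + t^*))); last by field; rewrite rw w0.
rewrite !normcM !normcX normcV normcV normc_conj divff ?normc_eq0 //.
have nz : normc z = 1 by apply: (@complexI R); rewrite -normrE z1.
have nw : normc w = 1 by apply: (@complexI R); rewrite -normrE w1.
rewrite nz nw !expr1n invr1 !mul1r.
rewrite -[t^*]/(conjc t) addcJ -normc_real; congr normc.
by rewrite rmorphB rmorphM !rmorph_nat.
Qed.

Lemma Re_oneD_iM (x : R) : complex.Re (1 + 'i * x%:C : C) = 1.
Proof. by rewrite ReD Re_iM oppr0 addr0. Qed.

Lemma oneD_iM_neq0 (x : R) : 1 + 'i * x%:C != 0 :> C.
Proof.
apply/eqP => /(congr1 (@complex.Re R)) /eqP.
by rewrite Re_oneD_iM oner_eq0.
Qed.

Lemma oneB_iM_neq0 (x : R) : 1 - 'i * x%:C != 0 :> C.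
Proof. by rewrite -mulrN -rmorphN; exact: oneD_iM_neq0. Qed.

Lemma norm_cayley_inv (x : R) : `|cayley_inv x%:C| = 1.
Proof.
have x0 := oneB_iM_neq0 x.
rewrite normrM normrV ?unitfE // -(norm_conjC (1 - _)).
rewrite rmorphB rmorphM /= rmorph1 conjCi mulNr opprK.
have -> : (x%:C)^* = x%:C by apply/CrealP/complex_realP; exists x.
by rewrite divff // normr_eq0 oneD_iM_neq0.
Qed.

(** The denominators of [cayley_inv] are cleared coefficient by coefficient, which gives a genuine
    polynomial in the half-plane variable, open to the formal derivative. *)
Definition halfplane_poly (n : nat) (r : {poly C}) (gamma : C) : {poly C} :=
  \sum_(j < n.+1) (r`_j * gamma ^+ j) *:
    ((1 + 'i *: 'X) ^+ j * (1 - 'i *: 'X) ^+ (n - j)).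

Lemma halfplane_polyE n (r : {poly C}) (gamma v : C) : (size r <= n.+1)%N ->
  1 - 'i * v != 0 -> (halfplane_poly n r gamma).[v] =
  (1 - 'i * v) ^+ n * r.[gamma * cayley_inv v].
Proof.
move=> rn v0; rewrite (horner_coef_wide _ rn) mulr_sumr horner_sum.
apply: eq_bigr => j _; rewrite hornerZ hornerM !horner_exp.
have -> : (1 + 'i *: 'X).[v] = 1 + 'i * v by rewrite !hornerE.
have -> : (1 - 'i *: 'X).[v] = 1 - 'i * v by rewrite !hornerE.
have jn : (j <= n)%N by rewrite -ltnS.
rewrite exprMn /cayley_inv expr_div_n exprB ?unitfE //; field.
by rewrite expf_neq0.
Qed.

(** This is the chain rule for [w = gamma * cayley_inv v], where [dw/dv = 2 i w / (1 + v^2)]; the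
    term with [n] comes from the factor [(1 - i v)^n]. It is checked on each basis element
    [(1 + i v)^j (1 - i v)^(n - j)]. *)
Lemma deriv_halfplane_poly n (r : {poly C}) (gamma v : C) :
  (size r <= n.+1)%N -> 1 - 'i * v != 0 -> 1 + 'i * v != 0 ->
  (1 + v ^+ 2) * ((halfplane_poly n r gamma)^`()%R).[v] =
  'i * (2 * ((1 - 'i * v) ^+ n *
    (gamma * cayley_inv v * (r^`()%R).[gamma * cayley_inv v])) -
        n%:R * (1 + 'i * v) * (halfplane_poly n r gamma).[v]).
Proof.
move=> rn v0 v0'; set w := gamma * cayley_inv v.
have -> : w * (r^`()%R).[w] = \sum_(j < n.+1) j%:R * (r`_j * w ^+ j).
  have sn : (size (r^`()%R) <= n)%N.
    by apply: leq_trans (size_poly _ _) _; rewrite -subn1 leq_subLR.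
  rewrite (horner_coef_wide _ sn) mulr_sumr big_ord_recl mul0r add0r.
  apply: eq_bigr => j _; rewrite lift0 coef_deriv exprS.
  by rewrite -mulr_natl; ring.
rewrite halfplane_polyE // (horner_coef_wide _ rn) !mulr_sumr -sumrB mulr_sumr.
rewrite raddf_sum horner_sum mulr_sumr; apply: eq_bigr => j _ /=.
have jn : (j <= n)%N by rewrite -ltnS.
have i2 : 'i ^+ 2 = -1 :> C by rewrite sqrCi.
have dX (a : {poly C}) k :
    a.[v] * ((a ^+ k)^`()%R).[v] = k%:R * (a^`()%R).[v] * a.[v] ^+ k.
  case: k => [|k]; first by rewrite expr0 derivC horner0 mulr0 !mul0r.
  by rewrite deriv_exp hornerMn hornerM horner_exp exprS -mulr_natl; ring.
rewrite derivZ derivM hornerZ hornerD !hornerM !horner_exp.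
pose a : {poly C} := 1 + 'i *: 'X; pose b : {poly C} := 1 - 'i *: 'X.
rewrite -/a -/b; set k := (n - j)%N.
have aE : a.[v] = 1 + 'i * v by rewrite !hornerE.
have bE : b.[v] = 1 - 'i * v by rewrite !hornerE.
have da : (a^`()%R).[v] = 'i by rewrite derivD derivC derivZ derivX !hornerE.
have db : (b^`()%R).[v] = - 'i by rewrite derivB derivC derivZ derivX !hornerE.
have := dX a j; have := dX b k.
rewrite aE bE da db => hb ha.
have -> : 1 + v ^+ 2 = (1 + 'i * v) * (1 - 'i * v).
  by rewrite -[1 in X in X + _]/1; ring: i2.
have -> : w ^+ j = gamma ^+ j * ((1 + 'i * v) ^+ j / (1 - 'i * v) ^+ j).
  by rewrite exprMn /cayley_inv expr_div_n.
have -> : (1 - 'i * v) ^+ n = (1 - 'i * v) ^+ k * (1 - 'i * v) ^+ j.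
  by rewrite -exprD subnK.
have -> : n%:R = k%:R + j%:R :> C by rewrite -natrD subnK.
have Bj : (1 - 'i * v) ^+ j != 0 by rewrite expf_neq0.
pose A : C := 1 + 'i * v; pose B : C := 1 - 'i * v.
rewrite -/A in ha *; rewrite -/B in hb Bj *.
have AB : A + B = 2 by rewrite /A /B; ring.
rewrite [LHS](_ : _ = r`_j * gamma ^+ j *
  (B * (A * ((a ^+ j)^`()%R).[v]) * B ^+ k +
   A * A ^+ j * (B * ((b ^+ k)^`()%R).[v]))); last by ring.
by rewrite ha hb -AB; field.
Qed.

(** With [t] the Euler logarithmic derivative of the slice at [w],
    [(1 + v^2) Q'/Q = i (2 t - n (1 + i v))]. As [v] is real, its imaginary part is [2 Re t - n], up
    to sign the quantity in [normc_deriv_rif]. *)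
Lemma normc_deriv_rif_halfplane m n (p : {poly {poly C}}) (z gamma : C) (v : R) :
  (size p <= m.+1)%N -> (forall i, (size (p`_i)%R <= n.+1)%N) ->
  `|z| = 1 -> `|gamma| = 1 ->
  let Q := halfplane_poly n p.[z%:P] gamma in Q.[v%:C] != 0 ->
  normc (derive1 (fun z2 => rif m n p z z2) (gamma * cayley_inv v%:C)) =
  (1 + v ^+ 2) * `|complex.Im ((Q^`()%R).[v%:C] / Q.[v%:C])|.
Proof.
move=> pm pn z1 g1 Q Qv.
have rn : (size (p.[z%:P])%R <= n.+1)%N by exact: size_horner_outer.
have v0 : 1 - 'i * v%:C != 0 :> C by exact: oneB_iM_neq0.
set w := gamma * cayley_inv v%:C.
have w1 : `|w| = 1 by rewrite normrM g1 mul1r norm_cayley_inv.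
have QE := halfplane_polyE gamma rn v0; rewrite -/Q -/w in QE.
have rw : p.[z, w] != 0.
  by apply: contra_neq Qv => rw; rewrite QE rw mulr0.
have dQ := deriv_halfplane_poly gamma rn v0 (oneD_iM_neq0 v); rewrite -/Q -/w in dQ.
rewrite normc_deriv_rif //; set t := w * _ / _.
have v2 : 0 <= 1 + v ^+ 2 by rewrite addr_ge0 ?sqr_ge0.
rewrite -(ger0_norm v2) -normrM -Im_realM mulrA.
have -> : (1 + v ^+ 2)%:C * (Q^`()%R).[v%:C] / Q.[v%:C] =
    'i * (2 * t - n%:R * (1 + 'i * v%:C)).
  rewrite rmorphD rmorphXn /= dQ QE /t; field.
  by rewrite rw expf_neq0.
rewrite Im_iM ReD ReN distrC; congr `|_ - _|.
  by rewrite -(rmorph_nat (real_complex R)) Re_realM.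
by rewrite -(rmorph_nat (real_complex R)) Re_realM Re_oneD_iM mulr1.
Qed.
End Weight.

(** * Logarithmic derivatives and lowest order terms *)

Section LogarithmicDerivative.
Variable R : realType.
Local Notation C := R[i].
Implicit Types (P Q : {poly C}) (w : C).

Lemma horner_taylor2 (q : {poly C}) w : exists s : {poly C}, forall h : C,
  q.[w + h] = q.[w] + h * (q^`()%R).[w] + h ^+ 2 * s.[h].
Proof.
elim/poly_ind: q => [|q c [s sP]].
  by exists 0 => h; rewrite deriv0 !horner0; ring.
exists (w *: s + (q^`()%R).[w]%:P + s * 'X) => h.
rewrite derivD derivM derivX derivC mulr1 addr0 !(hornerE, hornerZ) sP.
ring.
Qed.

Lemma horner_bounded (q : {poly C}) :
  exists2 B : R, 0 <= B & forall h : C, normc h <= 1 -> normc q.[h] <= B.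
Proof.
elim/poly_ind: q => [|q c [B B0 BP]].
  by exists 0 => // h _; rewrite horner0 normc0.
exists (B + normc c) => [|h h1]; first by rewrite addr_ge0 ?normc_ge0.
rewrite !hornerE; apply: le_trans (le_normcD _ _) _; rewrite lerD2r normcM.
by rewrite -[B]mulr1 ler_pM ?normc_ge0 ?BP.
Qed.

(* [u] is only known to be Lipschitz, so that its derivative is avoided. *)
Lemma deriv_lipschitz_factor Q P (u : C -> C) w (Lam d : R) : 0 <= Lam ->
  0 < d ->
  (forall h, normc h < d -> Q.[w + h] = u (w + h) * P.[w + h]) ->
  (forall h, normc h < d -> normc (u (w + h) - u w) <= Lam * normc h) ->
  normc ((Q^`()%R).[w] - u w * (P^`()%R).[w]) <= Lam * normc P.[w].
Proof.
move=> Lam0 d0 QuP uLip.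
have [sQ sQP] := horner_taylor2 Q w; have [sP sPP] := horner_taylor2 P w.
have [BQ BQ0 BQP] := horner_bounded sQ; have [BP BP0 BPP] := horner_bounded sP.
set D := _ - _.
pose K := Lam * (normc (P^`()%R).[w] + BP) + BQ + normc (u w) * BP + 1.
have K0 : 0 < K by rewrite ltr_wpDl // !addr_ge0 ?mulr_ge0 ?addr_ge0 ?normc_ge0.
apply: le_eps => eps eps0.
pose t : R := Num.min (d / 2) (Num.min 1 (eps / K)).
have t0 : 0 < t by rewrite !lt_min divr_gt0 // ltr01 divr_gt0.
have td : t < d.
  by rewrite /t gt_min ltr_pdivrMr // ltr_pMr // ltr1n.
have t1 : t <= 1 by rewrite /t !ge_min lexx /= orbT.
have tK : t * K <= eps by rewrite -ler_pdivlMr // /t !ge_min lexx !orbT.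
have nt : normc t%:C = t by rewrite normc_real gtr0_norm.
(* Subtracting [u w] times the expansion of [P] from that of [Q] cancels the values at [w]. The
   second order terms are collected in [K], so dividing by [t] leaves an error of at most
   [t * K <= eps]. *)
have tE : t%:C * D = (u (w + t%:C) - u w) * P.[w + t%:C] -
    t%:C ^+ 2 * (sQ.[t%:C] - u w * sP.[t%:C]).
  have Q0 := QuP 0; rewrite normc0 !addr0 in Q0.
  have := QuP t%:C; rewrite nt => /(_ td).
  rewrite sQP Q0 // => e1.
  rewrite mulrBl -e1 sPP /D; ring.
have h1 : normc (P.[w + t%:C]) <= normc P.[w] + t * (normc (P^`()%R).[w] + BP).
  rewrite sPP -addrA; apply: le_trans (le_normcD _ _) _; rewrite lerD2l.
  rewrite expr2 -mulrA -mulrDr normcM nt ler_wpM2l ?(ltW t0) //.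
  apply: le_trans (le_normcD _ _) _; rewrite lerD2l normcM nt -[BP]mul1r.
  by rewrite ler_pM ?normc_ge0 ?BPP ?nt ?(ltW t0).
have h2 : normc (sQ.[t%:C] - u w * sP.[t%:C]) <= BQ + normc (u w) * BP.
  apply: le_trans (normcB _ _) _.
  by rewrite normcM lerD ?BQP ?ler_wpM2l ?normc_ge0 ?BPP ?nt.
have h3 := uLip t%:C; rewrite nt in h3; have {}h3 := h3 td.
have : t * normc D <= t * (Lam * normc P.[w] + t * K).
  rewrite -{1}nt -normcM tE; apply: le_trans (normcB _ _) _.
  rewrite normcM normcM normcX nt.
  have h4 : normc (u (w + t%:C) - u w) * normc P.[w + t%:C] <=
      Lam * t * (normc P.[w] + t * (normc (P^`()%R).[w] + BP)).
    by rewrite ler_pM ?normc_ge0.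
  have h5 : t ^+ 2 * normc (sQ.[t%:C] - u w * sP.[t%:C]) <=
      t ^+ 2 * (BQ + normc (u w) * BP) by rewrite ler_wpM2l ?sqr_ge0.
  apply: le_trans (lerD h4 h5) _; rewrite -subr_ge0.
  rewrite [X in 0 <= X](_ : _ = t ^+ 2); last by rewrite /K; ring.
  exact: sqr_ge0.
rewrite ler_pM2l // => /le_trans; apply.
by rewrite lerD2l.
Qed.

(** The difference stands for [u' / u]: the previous bound is divided by the modulus of [u w *
    P.[w]], and that of [P.[w]] cancels. *)
Lemma log_deriv_lipschitz_factor Q P (u : C -> C) w (Lam d c : R) :
  0 <= Lam -> 0 < d -> 0 < c -> c <= normc (u w) -> P.[w] != 0 ->
  (forall h, normc h < d -> Q.[w + h] = u (w + h) * P.[w + h]) ->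
  (forall h, normc h < d -> normc (u (w + h) - u w) <= Lam * normc h) ->
  normc ((Q^`()%R).[w] / Q.[w] - (P^`()%R).[w] / P.[w]) <= Lam / c.
Proof.
move=> Lam0 d0 c0 cu Pw QuP uLip.
have uw : u w != 0 by rewrite -normc_eq0 gt_eqF // (lt_le_trans c0).
have h := deriv_lipschitz_factor Lam0 d0 QuP uLip.
have Q0 := QuP 0; rewrite normc0 !addr0 in Q0; rewrite Q0 //.
rewrite [X in normc X](_ : _ = ((Q^`()%R).[w] - u w * (P^`()%R).[w]) /
  (u w * P.[w])); last by field; rewrite uw Pw.
rewrite normcM normcV normcM invfM mulrA [leRHS](_ : _ =
  Lam * normc P.[w] / normc P.[w] / c); last first.
  by rewrite mulfK // normc_eq0.
rewrite mulrAC ler_pM ?mulr_ge0 ?invr_ge0 ?normc_ge0 //.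
  by rewrite ler_wpM2r ?invr_ge0 ?normc_ge0.
by rewrite lef_pV2 ?posrE // (lt_le_trans c0).
Qed.

Lemma log_deriv_prod (I : Type) (r : seq I) (q : I -> {poly C}) w :
  (forall i, (q i).[w] != 0) ->
  ((\prod_(i <- r) q i)^`()%R).[w] / (\prod_(i <- r) q i).[w] =
  \sum_(i <- r) ((q i)^`()%R).[w] / (q i).[w].
Proof.
move=> qw; elim: r => [|i r IH].
  by rewrite !big_nil derivC horner0 mul0r.
have rw : (\prod_(i <- r) q i).[w] != 0.
  rewrite horner_prod prodf_seq_neq0.
  by apply: sub_all (all_predT r) => j _; exact: qw.
rewrite !big_cons -IH derivM hornerD !hornerM; field.
by rewrite rw qw.
Qed.

Lemma Im_inv w : complex.Im w^-1 = - (complex.Im w / normc w ^+ 2).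
Proof. by rewrite normc_sqr; case: w. Qed.

End LogarithmicDerivative.

Section LowestOrderTerm.
Variable R : realType.
Implicit Types H : {poly R}.

Lemma horner_low_vanish H N : (forall i, (i <= N)%N -> H`_i = 0) ->
  exists2 B : R, 0 < B & forall x, `|x| <= 1 -> `|H.[x]| <= B * `|x| ^+ N.+1.
Proof.
move=> HN; exists (\sum_(i < size H) `|H`_i| + 1) => [|x x1].
  by rewrite ltr_wpDl // sumr_ge0.
rewrite horner_coef; apply: le_trans (ler_norm_sum _ _ _) _.
rewrite mulrDl mulr_suml; apply: ler_wpDr; first by rewrite mul1r exprn_ge0.
apply: ler_sum => i _; have [iN|Ni] := leqP i N.
  by rewrite HN // !(normr0, mul0r).
by rewrite normrM normrX ler_wpM2l // ler_wiXn2l.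
Qed.

(** After division by its power of [x], the lowest nonzero coefficient dominates: near 0 the value
    stays above half of its modulus. *)
Lemma horner_low_nonzero H N : (exists2 i, (i <= N)%N & H`_i != 0) ->
  exists c r : R, [/\ 0 < c, 0 < r <= 1 &
    forall x, `|x| < r -> c * `|x| ^+ N <= `|H.[x]|].
Proof.
move=> [i0 i0N Hi0].
have ex : exists i, H`_i != 0 by exists i0.
case: (ex_minnP ex) => i Hi mini.
have iN : (i <= N)%N by apply: leq_trans i0N; exact: mini.
pose G : {poly R} := drop_poly i H.
have HE x : H.[x] = x ^+ i * G.[x].
  rewrite -{1}(poly_take_drop i H) hornerD hornerM hornerXn mulrC.
  rewrite (_ : take_poly i H = 0) ?horner0 ?add0r //.
  apply/polyP => j; rewrite coef_take_poly coef0; case: ltnP => // ji.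
  by apply/eqP; apply: contraTT ji => /mini; rewrite -leqNgt.
have [B B0 BP] : exists2 B : R, 0 < B &
    forall x, `|x| <= 1 -> `|(G - (H`_i)%:P).[x]| <= B * `|x| ^+ 1.
  apply: horner_low_vanish => j; rewrite leqn0 => /eqP ->.
  by rewrite coefB coefC coef_drop_poly add0n subrr.
pose c := `|H`_i| / 2; have c0 : 0 < c by rewrite divr_gt0 ?normr_gt0.
exists c, (Num.min 1 (c / B)); split=> // [|x].
  by rewrite lt_min ltr01 divr_gt0 //= ge_min lexx.
rewrite lt_min => /andP[x1 xB]; rewrite HE normrM normrX.
rewrite mulrC ler_pM ?exprn_ge0 ?(ltW c0) //; first by rewrite ler_wiXn2l ?(ltW x1).
have := BP x (ltW x1); rewrite expr1 hornerD hornerN hornerC => h.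
have hc : `|H`_i| = c + c by rewrite /c; field.
have hB : B * `|x| < c by rewrite mulrC -ltr_pdivlMr.
have := ler_distD G.[x] (H`_i) 0; rewrite !subr0 distrC hc; lra.
Qed.

End LowestOrderTerm.

(** * Asymptotics of the local factorizations *)

Section LocalData.
Variable R : realType.
Local Notation C := R[i].
Implicit Types (e x : R).

(** The smallness conditions below weaken as their constant decreases, so finitely many of them can
    share one. The cap at 1 lets powers of [x] be compared by their exponents. *)
Lemma uniform_eps (I : finType) (Q : I -> R -> Prop) :
  (forall i, exists2 e, 0 < e & Q i e) ->
  (forall i e e', 0 < e' -> e' <= e -> Q i e -> Q i e') ->
  exists2 e, 0 < e <= 1 & forall i, Q i e.
Proof.
move=> exQ monoQ.
suff [e e01 eP] : exists2 e, 0 < e <= 1 & forall i, i \in enum I -> Q i e.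
  by exists e => // i; apply: eP; rewrite mem_enum.
elim: (enum I) => [|i s [e /andP[e0 e1] eP]]; first by exists 1; rewrite ?ltr01 /=.
have [d d0 dP] := exQ i.
have m0 : 0 < Num.min d e by rewrite lt_min d0.
exists (Num.min d e) => [|j]; first by rewrite m0 ge_min e1 orbT.
rewrite inE => /orP[/eqP ->|js].
  by apply: monoQ dP => //; rewrite ge_min lexx.
by apply: monoQ (eP _ js) => //; rewrite ge_min lexx orbT.
Qed.

Lemma evalR_real (f : {poly R}) x : evalR f x%:C = (f.[x])%:C.
Proof. by rewrite /evalR horner_map. Qed.

Lemma normc_mu (M : nat) : normc (mu R M) = 1.
Proof. by rewrite /mu /= cos2Dsin2 sqrtr1. Qed.

(** Smallness is imposed on [normc z ^+ M] because [z] will be an [M]-th root of the real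
    variable. *)
Lemma analytic_Im_bound (psi : C -> C) (M : nat) : (0 < M)%N ->
  analytic_at psi 0 -> 0 < complex.Im (psi 0) ->
  exists2 e, 0 < e & forall z, normc z ^+ M < e ->
    e <= complex.Im (psi z) /\ normc (psi z) <= e^-1.
Proof.
move=> M0 /analytic_lipschitz[r [K [r0 K0 KP]]] I0.
set I := complex.Im (psi 0) in I0 *.
pose rho := Num.min r (I / (2 * K)).
have rho0 : 0 < rho by rewrite lt_min r0 divr_gt0 // mulr_gt0.
have B0 : 0 < normc (psi 0) + I by rewrite ltr_wpDl ?normc_ge0.
exists (Num.min (rho ^+ M) (Num.min (I / 2) (normc (psi 0) + I)^-1)).
  by rewrite !lt_min exprn_gt0 // divr_gt0 // invr_gt0.
move=> z; rewrite lt_min => /andP[zM _].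
have zrho : normc z < rho by move: zM; rewrite ltr_pXn2r ?nnegrE ?normc_ge0 ?ltW.
move: zrho; rewrite lt_min => /andP[zr zI].
have := KP z; rewrite subr0 => /(_ zr) h.
have hI : normc (psi z - psi 0) <= I / 2.
  apply: le_trans h _; rewrite mulrC -ler_pdivlMr //.
  by apply: le_trans (ltW zI) _; rewrite invfM mulrA.
have := le_trans (normc_Im (psi z - psi 0)) hI.
rewrite ImD ImN -/I ler_norml => /andP[hIm _].
split; first by rewrite !ge_min; apply/orP; right; apply/orP; left; lra.
apply: le_trans (_ : normc (psi 0) + I <= _).
  have := le_normcD (psi z - psi 0) (psi 0); rewrite subrK.
  by move: I0 hI; clear; lra.
rewrite -[leLHS]invrK lef_pV2 ?posrE ?invr_gt0 ?ge_min ?lexx ?orbT //.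
by rewrite !lt_min exprn_gt0 // divr_gt0 // invr_gt0.
Qed.

Section Factorizations.
Variables (q : C -> C -> C) (J : nat) (M L : 'I_J -> nat) (f : 'I_J -> {poly R}).

(** One shape for the factors of [q] and of [q^sharp - alpha q]: the value [a] has positive
    imaginary part for the former and is real for the latter. *)
Definition factor (a : C) (k : 'I_J) x (w : C) : C :=
  w + ((f k).[x])%:C + (x ^+ (2 * L k))%:C * a.

(** For real [x] one root of [x] can be chosen once for all. The [psi] then become mere values
    [a k l x], of which only bounds are kept. *)
Lemma local_roots : local_factorization q M L f ->
  exists e (u : C -> C -> C) (a : 'I_J -> nat -> R -> C), 0 < e <= 1 /\
  [/\ forall k l x, `|x| < e ->
        e <= complex.Im (a k l x) /\ normc (a k l x) <= e^-1,
      forall x w, `|x| < e -> normc w < e -> q x%:C w =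
        u x%:C w * \prod_(k < J) \prod_(1 <= l < (M k).+1) factor (a k l x) k x w,
      forall x w, `|x| < e -> normc w < e -> e <= normc (u x%:C w) &
      forall x w w', `|x| < e -> normc w < e -> normc w' < e ->
        normc (u x%:C w - u x%:C w') <= e^-1 * normc (w - w')].
Proof.
move=> [_ [fP [u [psi [/analytic2_lipschitz[r [K [r0 K0 KP]]] u0 psiP qP]]]]].
have [r' r'0 {}qP] := near_cplx2 qP.
have [e1 /andP[e10 e11] e1P] : exists2 e, 0 < e <= 1 & forall k z,
    normc z ^+ M k < e -> e <= complex.Im (psi k z) /\ normc (psi k z) <= e^-1.
  apply: uniform_eps => [k|k e e' e'0 e'e eP z ze].
    have [an im] := psiP k; have [M0 _ _ _ _] := fP k.
    exact: analytic_Im_bound.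
  have [h1 h2] := eP z (lt_le_trans ze e'e); split; first exact: le_trans e'e h1.
  by apply: le_trans h2 _; rewrite lef_pV2 ?posrE // (lt_le_trans e'0).
pose N0 := normc (u 0 0); have N00 : 0 < N0 by rewrite normc_gt0.
(* The entry [N0 / (4 * K)] keeps [u] within [N0 / 2] of [u 0 0], hence of modulus at least
   [N0 / 2 >= e]; the entry [K^-1] makes [e^-1] a Lipschitz constant. *)
pose e := Num.min e1 (Num.min r (Num.min r' (Num.min (N0 / 2)
            (Num.min (N0 / (4 * K)) K^-1)))).
have e0 : 0 < e.
  by rewrite !lt_min e10 r0 r'0 !divr_gt0 ?mulr_gt0 // invr_gt0.
have e1P' : e <= e1 by rewrite /e ge_min lexx.
have er : e <= r by rewrite /e !ge_min lexx !orbT.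
have er' : e <= r' by rewrite /e !ge_min lexx !orbT.
have eN : e <= N0 / 2 by rewrite /e !ge_min lexx !orbT.
have eK : 4 * K * e <= N0.
  by rewrite mulrC -ler_pdivlMr ?mulr_gt0 // /e !ge_min lexx !orbT.
have Ke : K <= e^-1.
  rewrite -[K]invrK lef_pV2 ?posrE ?invr_gt0 //.
  by rewrite /e !ge_min lexx !orbT.
have nx x : normc x%:C = `|x| by rewrite normc_real.
pose a k l x := psi k (mu R (M k) ^+ l * (M k).-root x%:C).
have rootM k x : ((M k).-root x%:C : C) ^+ M k = x%:C.
  by rewrite rootCK //; have [] := fP k.
exists e, u, a; split; first by rewrite e0 (le_trans e1P').
split.
- move=> k l x xe; have [|h1 h2] := e1P k (mu R (M k) ^+ l * (M k).-root x%:C).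
    rewrite normcM exprMn -(normcX (_.-root _)) rootM nx normcX normc_mu !expr1n.
    by rewrite mul1r (lt_le_trans xe).
  split; first exact: le_trans h1.
  by apply: le_trans h2 _; rewrite lef_pV2 ?posrE.
- move=> x w xe we.
  rewrite (qP x%:C w _ _ (fun k => (M k).-root x%:C)) ?nx ?(lt_le_trans _ er') //=.
  congr (_ * _); apply: eq_bigr => k _; apply: eq_bigr => l _.
  by rewrite /factor evalR_real rmorphXn.
- move=> x w xe we; have h : normc (u x%:C w - u 0 0) <= K * (`|x| + normc w).
    have := KP x%:C w 0 0; rewrite !subr0 normc0 nx.
    by apply; rewrite ?(lt_le_trans _ er).
  have h' := normc_dist (u 0 0) (u x%:C w).
  have : K * (`|x| + normc w) <= K * (e + e).
    by rewrite ler_wpM2l ?(ltW K0) // lerD // ltW.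
  have := ler_norm (normc (u 0 0) - normc (u x%:C w)).
  rewrite normcC in h'; move: h h' eK eN; rewrite -/N0; lra.
- move=> x w w' xe we w'e; have := KP x%:C w x%:C w'.
  rewrite !nx subrr normc0 add0r => h.
  apply: le_trans (h _ _ _ _) _; rewrite ?(lt_le_trans _ er) //.
  by rewrite ler_wpM2r ?normc_ge0.
Qed.

(** The bound on [psi k l x%:C - psi k l 0] serves to replace a branch by a polynomial up to one
    order more. *)
Lemma level_roots (psi : 'I_J -> nat -> C -> C) :
  level_factorization q M L f psi ->
  exists e (u : C -> C -> C), 0 < e <= 1 /\
  [/\ forall k l, (1 <= l <= M k)%N -> forall x, `|x| < e ->
        [/\ psi k l x%:C \is Num.real,
            normc (psi k l x%:C - psi k l 0) <= e^-1 * `|x| &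
            normc (psi k l x%:C) <= e^-1],
      forall x w, `|x| < e -> normc w < e -> q x%:C w =
        u x%:C w * \prod_(k < J) \prod_(1 <= l < (M k).+1)
                     factor (psi k l x%:C) k x w &
      forall x w, `|x| < e -> normc w < e -> normc (u x%:C w) <= e^-1].
Proof.
move=> [u [/analytic2_lipschitz[r [K [r0 K0 KP]]] u0 psiP qP]].
have [r' r'0 {}qP] := near_cplx2 qP.
pose good k l e := forall x, `|x| < e ->
        [/\ psi k l x%:C \is Num.real,
            normc (psi k l x%:C - psi k l 0) <= e^-1 * `|x| &
            normc (psi k l x%:C) <= e^-1].
have good_mono k l e e' : 0 < e' -> e' <= e -> good k l e -> good k l e'.
  move=> e'0 e'e ge x xe'; have [h1 h2 h3] := ge x (lt_le_trans xe' e'e).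
  have ee' : e^-1 <= e'^-1 by rewrite lef_pV2 ?posrE // (lt_le_trans e'0).
  split=> //; last exact: le_trans ee'.
  by apply: le_trans h2 _; rewrite ler_wpM2r.
have goodP k l : (1 <= l <= M k)%N -> exists2 e, 0 < e & good k l e.
  move=> /psiP[/analytic_lipschitz[s [B [s0 B0 BP]]] /near_real0[t t0 tP]].
  pose B' := B * s + normc (psi k l 0).
  have B'0 : 0 < B' by rewrite ltr_pwDl ?mulr_gt0 ?normc_ge0.
  exists (Num.min (Num.min s t) (Num.min B^-1 B'^-1)).
    by rewrite !lt_min s0 t0 !invr_gt0 B0.
  move=> x; rewrite !lt_min -!andbA => /and4P[xs xt _ _].
  have := BP x%:C; rewrite subr0 normc_real => /(_ xs) h.
  have inv b : 0 < b -> Num.min (Num.min s t) (Num.min B^-1 B'^-1) <= b^-1 ->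
      b <= (Num.min (Num.min s t) (Num.min B^-1 B'^-1))^-1.
    move=> b0 hb; rewrite -[leLHS]invrK lef_pV2 ?posrE ?invr_gt0 //.
    by rewrite !lt_min s0 t0 !invr_gt0 B0.
  split; first exact: tP.
    by apply: le_trans h _; rewrite ler_wpM2r // inv // !ge_min lexx !orbT.
  apply: le_trans (_ : B' <= _).
    have := le_normcD (psi k l x%:C - psi k l 0) (psi k l 0); rewrite subrK.
    have : B * `|x| <= B * s by rewrite ler_wpM2l ?ltW.
    by rewrite /B'; move: h; lra.
  by rewrite inv // !ge_min lexx !orbT.
have [e1 /andP[e10 e11] e1P] : exists2 e, 0 < e <= 1 &
    forall k, forall l, (1 <= l <= M k)%N -> good k l e.
  apply: uniform_eps => [k|k e e' e'0 e'e gk l lk]; last first.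
    exact: good_mono (gk l lk).
  (* The range of [l] is embedded in a finite type; its element 0 is a dummy. *)
  have [e /andP[e0 _] eP] : exists2 e, 0 < e <= 1 &
      forall l : 'I_(M k).+1, (0 < l)%N -> good k l e.
    apply: uniform_eps => [l|l e e' e'0 e'e gl l0]; last first.
      exact: good_mono (gl l0).
    case: (posnP l) => [->|l0]; first by exists 1.
    have [|e e0 eP] := goodP k l; first by rewrite l0 -ltnS ltn_ord.
    by exists e.
  exists e => // l /andP[l0 lM]; rewrite -ltnS in lM.
  exact: (eP (Ordinal lM)).
pose B := normc (u 0 0) + 2 * K.
have B0 : 0 < B by rewrite ltr_wpDl ?normc_ge0 ?mulr_gt0.
pose e := Num.min e1 (Num.min r (Num.min r' B^-1)).
have e0 : 0 < e by rewrite !lt_min e10 r0 r'0 invr_gt0.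
have e1P' : e <= e1 by rewrite /e ge_min lexx.
have er : e <= r by rewrite /e !ge_min lexx !orbT.
have er' : e <= r' by rewrite /e !ge_min lexx !orbT.
have Be : B <= e^-1.
  rewrite -[B]invrK lef_pV2 ?posrE ?invr_gt0 //.
  by rewrite /e !ge_min lexx !orbT.
have nx x : normc x%:C = `|x| by rewrite normc_real.
exists e, u; split; first by rewrite e0 (le_trans e1P').
split=> [k l lk|x w xe we|x w xe we].
- exact: good_mono (e1P k l lk).
- rewrite (qP x%:C w) ?nx ?(lt_le_trans _ er') //=.
  congr (_ * _); apply: eq_bigr => k _; apply: eq_bigr => l _.
  by rewrite /factor evalR_real rmorphXn.
- have h : normc (u x%:C w - u 0 0) <= K * (`|x| + normc w).
    have := KP x%:C w 0 0; rewrite !subr0 normc0 nx.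
    by apply; rewrite ?(lt_le_trans _ er).
  apply: le_trans Be.
  have := le_normcD (u x%:C w - u 0 0) (u 0 0); rewrite subrK.
  have : K * (`|x| + normc w) <= K * 2.
    rewrite ler_wpM2l ?(ltW K0) //; have e1' := le_trans e1P' e11.
    by have := lt_le_trans xe e1'; have := lt_le_trans we e1'; lra.
  by rewrite /B; move: h; lra.
Qed.

End Factorizations.
End LocalData.

(** * Uniqueness of the polynomials in the local factorization *)

Section Uniqueness.
Variable R : realType.
Local Notation C := R[i].
Implicit Types (e x : R).

(** Real parts tell the two sides apart when [L = L'], imaginary parts when the orders differ. *)
Lemma roots_separated (f g : {poly R}) (L L' : nat) e : 0 < e ->
  f != g -> (size f <= 2 * L)%N -> (size g <= 2 * L')%N ->
  exists2 d, 0 < d & forall x (b b' : C), 0 < x -> x < d ->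
    e <= complex.Im b -> normc b <= e^-1 ->
    e <= complex.Im b' -> normc b' <= e^-1 ->
    (f.[x])%:C + (x ^+ (2 * L))%:C * b != (g.[x])%:C + (x ^+ (2 * L'))%:C * b'.
Proof.
move=> e0; wlog LL' : f g L L' / (L <= L')%N.
  move=> W fg sf sg; have [LL'|/ltnW L'L] := leqP L L'; first exact: W.
  have [|d d0 dP] := W g f L' L L'L _ sg sf; first by rewrite eq_sym.
  by exists d => // x b b' x0 xd h1 h2 h3 h4; rewrite eq_sym dP.
move=> fg sf sg; move: LL'; rewrite leq_eqVlt => /orP[/eqP LE|LL'].
  (* Both degrees are below [2 * L], so the difference is at least a constant times
     [x ^+ (2 * L).-1]: one power of [x] is gained over the terms with [b] and [b']. *)
  have [i iL Gi] : exists2 i, (i <= (2 * L).-1)%N & (f - g)`_i != 0.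
    have G0 : f - g != 0 by rewrite subr_eq0.
    exists (size (f - g)).-1; last by rewrite -lead_coefE lead_coef_eq0.
    rewrite -!subn1 leq_sub2r // (leq_trans (size_polyD _ _)) // size_polyN geq_max sf.
    by rewrite LE.
  have L0 : (0 < 2 * L)%N.
    rewrite lt0n; apply: contra_neq fg => L0; move: sf sg.
    by rewrite -LE L0 !size_poly_leq0 => /eqP -> /eqP ->.
  have [|c [r [c0 /andP[r0 _] rP]]] := @horner_low_nonzero _ (f - g) (2 * L).-1.
    by exists i.
  exists (Num.min r (c * e / 2)); first by rewrite lt_min r0 divr_gt0 ?mulr_gt0.
  move=> x b b' x0; rewrite lt_min => /andP[xr xc] _ hb _ hb'; apply/eqP => E.
  have := rP x; rewrite gtr0_norm // => /(_ xr).
  have -> : (f - g).[x] = x ^+ (2 * L) * (complex.Re b' - complex.Re b).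
    have := congr1 (@complex.Re R) E; rewrite !ReD !Re_realM -LE /= => E'.
    by rewrite hornerD hornerN mulrBr; lra.
  rewrite -{2}(prednK L0) exprSr -mulrA mulrC normrM.
  rewrite (gtr0_norm (exprn_gt0 _ x0)) ler_pM2l ?exprn_gt0 //.
  rewrite normrM (gtr0_norm x0) => h.
  have h1 := le_trans (normc_Re b) hb; have h2 := le_trans (normc_Re b') hb'.
  have h3 := ler_normB (complex.Re b') (complex.Re b).
  have h4 : x * `|complex.Re b' - complex.Re b| <= x * (2 * e^-1).
    by rewrite ler_pM2l //; lra.
  have h5 : x * (2 * e^-1) < c.
    by rewrite mulrA ltr_pdivrMr // -ltr_pdivlMr.
  lra.
exists (Num.min 1 (e ^+ 2)); first by rewrite lt_min ltr01 exprn_gt0.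
move=> x b b' x0; rewrite lt_min => /andP[x1 xe] hb _ _ hb'; apply/eqP => E.
(* The left imaginary part is at least [e * x ^+ (2 * L)], while the right one is at most
   [e^-1 * x ^+ (2 * L')], smaller by at least one power of [x]. *)
have := congr1 (@complex.Im R) E; rewrite !ImD !Im_realM /= !add0r => E'.
have h1 := le_trans (normc_Im b') hb'; have h2 := ler_norm (complex.Im b').
have p0 : 0 < x ^+ (2 * L) by rewrite exprn_gt0.
have h3 : x ^+ (2 * L') <= x ^+ (2 * L) * x.
  by rewrite -exprSr ler_wiXn2l ?ltW // mul2n mul2n ltn_double.
have h4 : x ^+ (2 * L) * e <= x ^+ (2 * L) * (x * e^-1).
  rewrite mulrA; apply: le_trans (_ : x ^+ (2 * L) * complex.Im b <= _).
    by rewrite ler_pM2l.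
  rewrite E' ler_pM ?exprn_ge0 ?(ltW x0) //; last exact: le_trans h2 h1.
  rewrite -(pmulr_rge0 _ (exprn_gt0 (2 * L') x0)) -E' mulr_ge0 ?ltW //.
  exact: lt_le_trans e0 hb.
rewrite ler_pM2l // ler_pdivlMr // -expr2 in h4; lra.
Qed.

(** A root of the factor [k] at one small positive [x] makes [q] vanish, hence also a factor of the
    other factorization; [roots_separated] forces equal polynomials. *)
Lemma local_factorization_unique (q : C -> C -> C)
    (J : nat) (M L : 'I_J -> nat) (f : 'I_J -> {poly R})
    (J' : nat) (M' L' : 'I_J' -> nat) (f' : 'I_J' -> {poly R}) :
  local_factorization q M L f -> local_factorization q M' L' f' ->
  forall k, exists k', f k = f' k'.
Proof.
move=> qf qf' k; apply: contrapT => /forallNP ff'.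
have [_ [fP _]] := qf; have [_ [f'P _]] := qf'.
have [e [u [a [/andP[e0 e1] [aP qE _ _]]]]] := local_roots qf.
have [e' [u' [a' [/andP[e'0 e'1] [a'P qE' u'P _]]]]] := local_roots qf'.
pose m := Num.min e e'; have m0 : 0 < m by rewrite lt_min e0.
have me : m <= e by rewrite ge_min lexx.
have me' : m <= e' by rewrite ge_min lexx orbT.
have em : e^-1 <= m^-1 by rewrite lef_pV2 ?posrE.
have em' : e'^-1 <= m^-1 by rewrite lef_pV2 ?posrE.
have [d /andP[d0 d1] dP] : exists2 d, 0 < d <= 1 & forall k' x (b b' : C),
    0 < x -> x < d -> m <= complex.Im b -> normc b <= m^-1 ->
    m <= complex.Im b' -> normc b' <= m^-1 ->
    ((f k).[x])%:C + (x ^+ (2 * L k))%:C * b !=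
    ((f' k').[x])%:C + (x ^+ (2 * L' k'))%:C * b'.
  apply: uniform_eps => [k'|k' d d' d'0 d'd dP x b b' x0 xd].
    have [_ _ s _ _] := fP k; have [_ _ s' _ _] := f'P k'.
    by apply: roots_separated => //; apply/eqP.
  exact: dP (lt_le_trans xd d'd).
have [_ L0 _ fk0 _] := fP k; have [Mk0 _ _ _ _] := fP k.
have [B B0 BP] : exists2 B : R, 0 < B &
    forall x, `|x| <= 1 -> `|(f k).[x]| <= B * `|x| ^+ 1.
  apply: horner_low_vanish => i; rewrite leqn0 => /eqP ->.
  by rewrite -horner_coef0.
(* The second entry puts the root [w], of modulus at most [x * (B + m^-1)], where both
   factorizations hold. *)
pose x := Num.min (d / 2) (m / (2 * (B + m^-1))).
have Bm0 : 0 < B + m^-1 by rewrite addr_gt0 ?invr_gt0.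
have x0 : 0 < x by rewrite lt_min !divr_gt0 ?mulr_gt0.
have xd : x < d.
  by rewrite /x gt_min ltr_pdivrMr // ltr_pMr // ltr1n.
have xm : x * (B + m^-1) < m.
  have : x * (2 * (B + m^-1)) <= m.
    by rewrite -ler_pdivlMr ?mulr_gt0 // /x ge_min lexx orbT.
  have := mulr_gt0 x0 Bm0; lra.
have nx : `|x| = x by rewrite gtr0_norm.
have x1 : x <= 1 by rewrite (le_trans (ltW xd)).
have xem : x < m.
  have : x * m^-1 <= x * (B + m^-1) by rewrite ler_pM2l // lerDr ltW.
  have : x * 1 <= x * m^-1.
    by rewrite ler_pM2l // invf_ge1 // (le_trans me).
  lra.
pose w : C := - ((f k).[x])%:C - (x ^+ (2 * L k))%:C * a k 1 x.
have [a1 a2] := aP k 1 x (lt_le_trans (eq_ind_r (fun t => t < m) xem nx) me).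
have wm : normc w < m.
  apply: le_lt_trans xm; apply: le_trans (normcB _ _) _.
  rewrite normcN normcM !normc_real mulrDr normrX nx; apply: lerD.
    by rewrite mulrC; have := BP x; rewrite nx expr1; apply.
  apply: ler_pM; rewrite ?exprn_ge0 ?normc_ge0 ?(ltW x0) //.
    by rewrite -[leRHS]expr1 ler_wiXn2l ?(ltW x0) // muln_gt0.
  exact: le_trans a2 em.
have := qE x w; rewrite nx => /(_ (lt_le_trans xem me) (lt_le_trans wm me)).
have := qE' x w; rewrite nx => /(_ (lt_le_trans xem me') (lt_le_trans wm me')) ->.
move/eqP; rewrite (bigD1 k) //= big_ltn ?ltnS // [X in X * _ * _](_ : _ = 0).
  rewrite !mul0r mulr0 mulf_eq0 => /orP[/eqP u'0|].
    have := u'P x w; rewrite nx u'0 normc0 => /(_ (lt_le_trans xem me')).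
    by move=> /(_ (lt_le_trans wm me')); rewrite leNgt e'0.
  rewrite prodf_seq_eq0 => /hasP[k' _ /=]; rewrite prodf_seq_eq0.
  move=> /hasP[l' _ /=]; rewrite /factor => /eqP wE.
  have [a'1 a'2] := a'P k' l' x (lt_le_trans (eq_ind_r (fun t => t < m) xem nx) me').
  have := dP k' x (a k 1 x) (a' k' l' x) x0 xd (le_trans me a1) (le_trans a2 em)
    (le_trans me' a'1) (le_trans a'2 em').
  move/eqP; apply; apply/eqP; rewrite -subr_eq0 -oppr_eq0 -wE /w; apply/eqP.
  ring.
by rewrite /factor /w; ring.
Qed.

End Uniqueness.

(** * Uniform bounds and the values of the quotient along real curves *)

Section LocalModel.
Variable R : realType.
Local Notation C := R[i].
Implicit Types (e x : R) (q : C -> C -> C).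

(* The single constant [e] serves as radius, lower bound and, through [e^-1],
   upper bound; the conditions get weaker as [e] decreases. *)
Record local_model q q2 (J : nat) (M L : 'I_J -> nat)
    (f : 'I_J -> {poly R}) (psi : 'I_J -> nat -> C -> C)
    e (u u2 : C -> C -> C) (a : 'I_J -> nat -> R -> C) : Prop := LocalModel {
  lm_eps : 0 < e <= 1;
  lm_L k : (0 < L k)%N;
  lm_f k x : `|x| < e -> `|(f k).[x]| <= e^-1 * `|x|;
  lm_a k l x : `|x| < e -> e <= complex.Im (a k l x) /\ normc (a k l x) <= e^-1;
  lm_psi k l x : (1 <= l <= M k)%N -> `|x| < e ->
    [/\ psi k l x%:C \is Num.real,
        normc (psi k l x%:C - psi k l 0) <= e^-1 * `|x| &
        normc (psi k l x%:C) <= e^-1];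
  lm_q x w : `|x| < e -> normc w < e -> q x%:C w =
    u x%:C w * \prod_(k < J) \prod_(1 <= l < (M k).+1) factor L f (a k l x) k x w;
  lm_q2 x w : `|x| < e -> normc w < e -> q2 x%:C w =
    u2 x%:C w * \prod_(k < J) \prod_(1 <= l < (M k).+1)
                  factor L f (psi k l x%:C) k x w;
  lm_u x w : `|x| < e -> normc w < e -> e <= normc (u x%:C w);
  lm_u_lip x w w' : `|x| < e -> normc w < e -> normc w' < e ->
    normc (u x%:C w - u x%:C w') <= e^-1 * normc (w - w');
  lm_u2 x w : `|x| < e -> normc w < e -> normc (u2 x%:C w) <= e^-1 }.

Lemma local_modelP q q2 J (M L : 'I_J -> nat) f psi :
  local_factorization q M L f -> level_factorization q2 M L f psi ->
  exists e u u2 a, local_model q q2 M L f psi e u u2 a.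
Proof.
move=> qf q2f; have [_ [fP _]] := qf.
have [e1 [u [a [/andP[e10 e11] [aP qE uP uL]]]]] := local_roots qf.
have [e2 [u2 [/andP[e20 e21] [psiP q2E u2P]]]] := level_roots q2f.
have [e3 /andP[e30 e31] e3P] : exists2 e, 0 < e <= 1 & forall k x, `|x| < e ->
    `|(f k).[x]| <= e^-1 * `|x|.
  apply: uniform_eps => [k|k e e' e'0 e'e eP x xe]; last first.
    apply: le_trans (eP x (lt_le_trans xe e'e)) _.
    by rewrite ler_wpM2r // lef_pV2 ?posrE // (lt_le_trans e'0).
  have [B B0 BP] : exists2 B : R, 0 < B &
      forall x, `|x| <= 1 -> `|(f k).[x]| <= B * `|x| ^+ 1.
    apply: horner_low_vanish => i; rewrite leqn0 => /eqP ->.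
    by have [_ _ _ fk0 _] := fP k; rewrite -horner_coef0.
  exists (Num.min 1 B^-1); first by rewrite lt_min ltr01 invr_gt0.
  move=> x; rewrite lt_min => /andP[x1 _].
  apply: le_trans (BP x (ltW x1)) _; rewrite expr1 ler_wpM2r //.
  rewrite -[leLHS]invrK lef_pV2 ?posrE ?invr_gt0 ?ge_min ?lexx ?orbT //.
  by rewrite lt_min ltr01 invr_gt0.
pose e := Num.min e1 (Num.min e2 e3).
have e0 : 0 < e by rewrite !lt_min e10 e20.
have ee1 : e <= e1 by rewrite /e ge_min lexx.
have ee2 : e <= e2 by rewrite /e !ge_min lexx orbT.
have ee3 : e <= e3 by rewrite /e !ge_min lexx !orbT.
have ie1 : e1^-1 <= e^-1 by rewrite lef_pV2 ?posrE.
have ie2 : e2^-1 <= e^-1 by rewrite lef_pV2 ?posrE.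
have ie3 : e3^-1 <= e^-1 by rewrite lef_pV2 ?posrE.
exists e, u, u2, a; split.
- by rewrite e0 (le_trans ee1).
- by move=> k; have [] := fP k.
- move=> k x xe; apply: le_trans (e3P k x (lt_le_trans xe ee3)) _.
  by rewrite ler_wpM2r.
- move=> k l x xe; have [h1 h2] := aP k l x (lt_le_trans xe ee1).
  by split; [exact: le_trans ee1 h1|exact: le_trans h2 ie1].
- move=> k l x lk xe; have [h1 h2 h3] := psiP k l lk x (lt_le_trans xe ee2).
  split=> //; last exact: le_trans ie2.
  by apply: le_trans h2 _; rewrite ler_wpM2r.
- by move=> x w xe we; apply: qE; exact: lt_le_trans ee1.
- by move=> x w xe we; apply: q2E; exact: lt_le_trans ee2.
- move=> x w xe we; apply: (le_trans ee1).
  by apply: uP; exact: lt_le_trans ee1.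
- move=> x w w' xe we w'e; apply: le_trans (uL x w w' _ _ _) _;
    rewrite ?(lt_le_trans _ ee1) //.
  by rewrite ler_wpM2r ?normc_ge0.
- move=> x w xe we; apply: le_trans ie2.
  by apply: u2P; exact: lt_le_trans ee2.
Qed.

(* The quotient [qs / q] tends to [alpha] along the curve [z2 = - f z1]. *)
Definition curve_value q qs (f : {poly R}) (alpha : C) : Prop :=
  exists B d : R, 0 < d /\ forall x, 0 < `|x| < d ->
    q x%:C (- (f.[x])%:C) != 0 /\
    normc (qs x%:C (- (f.[x])%:C) - alpha * q x%:C (- (f.[x])%:C)) <=
      B * `|x| * normc (q x%:C (- (f.[x])%:C)).

(** At one small [x] the two estimates bound the distance of the values by half of itself, as [q]
    does not vanish there. *)
Lemma curve_value_unique q qs f alpha alpha' :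
  curve_value q qs f alpha -> curve_value q qs f alpha' -> alpha = alpha'.
Proof.
move=> [B [d [d0 BP]]] [B' [d' [d'0 B'P]]]; apply/eqP; rewrite -subr_eq0.
rewrite -normc_eq0; apply/negPn/negP => N0.
have {}N0 : 0 < normc (alpha - alpha') by rewrite lt_def N0 normc_ge0.
set N := normc _ in N0.
pose K := `|B| + `|B'| + 1.
have K0 : 0 < K by rewrite ltr_wpDl ?addr_ge0.
pose x := Num.min (d / 2) (Num.min (d' / 2) (N / (2 * K))).
have x0 : 0 < x by rewrite !lt_min !divr_gt0 ?mulr_gt0.
have xd : x < d.
  by rewrite /x gt_min ltr_pdivrMr // ltr_pMr // ltr1n.
have xd' : x < d'.
  by rewrite /x !gt_min (ltr_pdivrMr _ d') // ltr_pMr // ltr1n orbT.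
have xN : x * (2 * K) <= N.
  by rewrite -ler_pdivlMr ?mulr_gt0 // /x !ge_min lexx !orbT.
have nx : `|x| = x by rewrite gtr0_norm.
have [|q0 h] := BP x; first by rewrite nx x0.
have [|_ h'] := B'P x; first by rewrite nx x0.
move: q0 h h'; rewrite nx; set v := - _; set Q := q _ v; set S := qs _ v.
move=> q0 h h'; have Q0 : 0 < normc Q by rewrite normc_gt0.
have : N * normc Q <= x * K * normc Q.
  rewrite /N -normcM (_ : (alpha - alpha') * Q = (S - alpha' * Q) - (S - alpha * Q)).
    apply: le_trans (normcB _ _) _; apply: le_trans (lerD h' h) _.
    rewrite -mulrDl ler_pM2r // -mulrDl mulrC ler_pM2l // /K.
    by have := ler_norm B; have := ler_norm B'; lra.
  by ring.
by rewrite ler_pM2r // => h3; have := mulr_gt0 x0 K0; lra.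
Qed.

Section Estimates.
Variables (q q2 : C -> C -> C) (J : nat) (M L : 'I_J -> nat).
Variables (f : 'I_J -> {poly R}) (psi : 'I_J -> nat -> C -> C).
Variables (e : R) (u u2 : C -> C -> C) (a : 'I_J -> nat -> R -> C).
Hypothesis lm : local_model q q2 M L f psi e u u2 a.

Let e_gt0 : 0 < e. Proof. by have /andP[] := lm_eps lm. Qed.
Let e_le1 : e <= 1. Proof. by have /andP[] := lm_eps lm. Qed.

Lemma factor_real b k x v :
  factor L f b k x v%:C = (v + (f k).[x])%:C + (x ^+ (2 * L k))%:C * b.
Proof. by rewrite /factor rmorphD. Qed.

Lemma Im_factor b k x v :
  complex.Im (factor L f b k x v%:C) = x ^+ (2 * L k) * complex.Im b.
Proof. by rewrite factor_real ImD Im_realM add0r. Qed.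

Lemma pow2L_gt0 k x : x != 0 -> 0 < x ^+ (2 * L k).
Proof. by move=> x0; rewrite exprM exprn_gt0 // exprn_even_gt0. Qed.

Lemma Im_factor_ge k l x v : `|x| < e ->
  e * x ^+ (2 * L k) <= complex.Im (factor L f (a k l x) k x v%:C).
Proof.
move=> xe; rewrite Im_factor mulrC ler_wpM2l //.
  by rewrite exprM exprn_ge0 // sqr_ge0.
by have [] := lm_a lm k l xe.
Qed.

Lemma normc_factor_ge k l x v : `|x| < e ->
  e * x ^+ (2 * L k) <= normc (factor L f (a k l x) k x v%:C).
Proof.
move=> xe; apply: le_trans (Im_factor_ge k l v xe) _.
exact: le_trans (ler_norm _) (normc_Im _).
Qed.

Lemma factor_neq0 k l x v : x != 0 -> `|x| < e ->
  factor L f (a k l x) k x v%:C != 0.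
Proof.
move=> x0 xe; rewrite -normc_eq0 gt_eqF //.
by apply: lt_le_trans (normc_factor_ge k l v xe); rewrite mulr_gt0 ?pow2L_gt0.
Qed.

(** Exchanging [a] for [psi] moves the factor by at most [x ^+ (2 * L k) * (2 / e)], and
    [x ^+ (2 * L k)] is at most [e^-1] times the modulus on the right. *)
Lemma factor_level_le k l x v : `|x| < e -> (1 <= l <= M k)%N ->
  normc (factor L f (psi k l x%:C) k x v%:C) <=
  (1 + 2 * e^-1 ^+ 2) * normc (factor L f (a k l x) k x v%:C).
Proof.
move=> xe lk; have h := normc_factor_ge k l v xe.
set D := factor _ _ (a k l x) _ _ _ in h *.
have [a1 a2] := lm_a lm k l xe; have [_ _ p3] := lm_psi lm lk xe.
rewrite (_ : factor _ _ _ _ _ _ =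
   D + (x ^+ (2 * L k))%:C * (psi k l x%:C - a k l x)); last first.
  by rewrite /D /factor; ring.
apply: le_trans (le_normcD _ _) _; rewrite mulrDl mul1r lerD2l normcM normc_real.
rewrite ger0_norm; last by rewrite exprM exprn_ge0 // sqr_ge0.
apply: le_trans (_ : x ^+ (2 * L k) * (2 * e^-1) <= _).
  rewrite ler_wpM2l //; first by rewrite exprM exprn_ge0 // sqr_ge0.
  by apply: le_trans (normcB _ _) _; lra.
rewrite [leRHS](_ : _ = (2 * e^-1) * (e^-1 * normc D)); last by ring.
rewrite mulrC ler_wpM2l ?mulr_ge0 ?invr_ge0 ?(ltW e_gt0) //.
by rewrite mulrC ler_pdivlMr // mulrC.
Qed.

Lemma normc_oppf k x d : d <= e ^+ 2 -> `|x| < d -> normc (- ((f k).[x])%:C) < e.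
Proof.
move=> de xd; rewrite normcN normc_real; apply: le_lt_trans (lm_f lm k _) _.
  by apply: lt_le_trans xd _; apply: le_trans de _; rewrite expr2 ler_piMl ?(ltW e_gt0).
by rewrite mulrC ltr_pdivrMr // -expr2 (lt_le_trans xd).
Qed.

(* If the branch [(k0, l0)] agrees with [- f k] to order larger than
   [2 * L k0], its factor is negligible along [z2 = - f k z1], while the other
   factors of [q2] are bounded by those of [q]. *)
Lemma agreeing_curve_value (k0 k : 'I_J) l0 : (1 <= l0 <= M k0)%N ->
  (exists B d, 0 < d /\ forall x, `|x| < d ->
    `|(f k).[x] - (f k0).[x] - x ^+ (2 * L k0) * complex.Re (psi k0 l0 x%:C)| <=
    B * `|x| ^+ (2 * L k0).+1) ->
  exists B d : R, 0 < d /\ forall x, 0 < `|x| < d ->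
    q x%:C (- ((f k).[x])%:C) != 0 /\
    normc (q2 x%:C (- ((f k).[x])%:C)) <=
      B * `|x| * normc (q x%:C (- ((f k).[x])%:C)).
Proof.
move=> l0k [B [d [d0 BP]]].
have B0 : 0 <= `|B| by [].
(* The first two terms serve for the general factors, the last for the factor [(k0, l0)]. The weight
   [t] marks that factor, so the whole product gains [|x|] exactly once. *)
pose K := 1 + 2 * e^-1 ^+ 2 + `|B| / e.
pose t x k' l' : R := if (k' == k0) && (l' == l0) then `|x| else 1.
pose KK : R := \prod_(k' < J) \prod_(1 <= l' < (M k').+1) K.
exists (e^-1 * KK / e), (Num.min d (e ^+ 2)); split.
  by rewrite lt_min d0 exprn_gt0.
move=> x /andP[x0]; rewrite lt_min => /andP[xd xe2].
have xe : `|x| < e.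
  by apply: lt_le_trans xe2 _; rewrite expr2 ler_piMl ?(ltW e_gt0).
have {}x0 : x != 0 by rewrite -normr_gt0.
have ve := normc_oppf k (lexx _) xe2.
have vE : - ((f k).[x])%:C = (- (f k).[x])%:C by rewrite rmorphN.
rewrite vE in ve *; set v := - (f k).[x] in ve *.
rewrite (lm_q lm) // (lm_q2 lm) //.
have uv := lm_u lm xe ve; have u2v := lm_u2 lm xe ve.
have e2 : 0 <= 2 * e^-1 ^+ 2 by rewrite mulr_ge0 // sqr_ge0.
have Be : 0 <= `|B| / e by rewrite divr_ge0 // ltW.
have K1 : 0 < K by rewrite /K; lra.
split.
  rewrite mulf_neq0 //; first by rewrite -normc_eq0 gt_eqF // (lt_le_trans e_gt0).
  apply/prodf_neq0 => k' _; rewrite prodf_seq_neq0; apply/allP => l' _.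
  exact: factor_neq0.
rewrite !normcM !normc_prod.
have prodt : \prod_(k' < J) \prod_(1 <= l' < (M k').+1) t x k' l' = `|x|.
  rewrite (bigD1 k0) //= (bigD1_seq l0) ?mem_index_iota ?iota_uniq //=.
  rewrite /t !eqxx /= big1 ?mulr1 => [|l' /negPf ->] //.
  by rewrite big1 ?mulr1 // => k' /negPf k'0; rewrite big1 // => l' _; rewrite k'0.
have le_prod : \prod_(k' < J) normc (\prod_(1 <= l' < (M k').+1)
      factor L f (psi k' l' x%:C) k' x v%:C) <=
    \prod_(k' < J) \prod_(1 <= l' < (M k').+1)
      (K * t x k' l' * normc (factor L f (a k' l' x) k' x v%:C)).
  apply: ler_prod => k' _; rewrite normc_ge0 /= normc_prod.
  rewrite big_nat [leRHS]big_nat; apply: ler_prod => l' lk'.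
  rewrite normc_ge0 /= /t; case: ifP => [/andP[/eqP k'E /eqP l'E]|_]; last first.
    rewrite mulr1; apply: le_trans (factor_level_le v xe _) _ => //.
    by rewrite ler_wpM2r ?normc_ge0 // /K; lra.
  rewrite {}k'E {}l'E; set D := factor _ _ (a k0 l0 x) _ _ _.
  have hD : e * x ^+ (2 * L k0) <= normc D by exact: normc_factor_ge.
  have [pr _ _] := lm_psi lm l0k xe.
  rewrite factor_real -(RRe_real pr) -rmorphM -rmorphD normc_real.
  rewrite -[X in X <= _]normrN /v [X in `|X| <= _](_ : _ = (f k).[x] - (f k0).[x] -
    x ^+ (2 * L k0) * complex.Re (psi k0 l0 x%:C)); last by ring.
  apply: le_trans (BP x xd) _.
  have -> : `|x| ^+ (2 * L k0).+1 = `|x| * x ^+ (2 * L k0).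
    rewrite exprS; congr (_ * _); rewrite !exprM.
    by rewrite real_normK ?num_real.
  apply: le_trans (_ : `|B| / e * `|x| * (e * x ^+ (2 * L k0)) <= _).
    rewrite [leRHS](_ : _ = `|B| * (`|x| * x ^+ (2 * L k0))); last first.
      by field; rewrite gt_eqF.
    by rewrite ler_wpM2r ?ler_norm // mulr_ge0 ?(ltW (pow2L_gt0 _ x0)).
  apply: ler_pM => //; first by rewrite !mulr_ge0 ?invr_ge0 ?(ltW e_gt0).
    by rewrite mulr_ge0 ?(ltW e_gt0) // ltW // pow2L_gt0.
  by rewrite ler_wpM2r // /K; lra.
rewrite [X in _ <= _ * (_ * X)](_ : _ = \prod_(k' < J) \prod_(1 <= l' < (M k').+1)
    normc (factor L f (a k' l' x) k' x v%:C)); last first.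
  by apply: eq_bigr => k' _; rewrite normc_prod.
have KtD : \prod_(k' < J) \prod_(1 <= l' < (M k').+1)
      (K * t x k' l' * normc (factor L f (a k' l' x) k' x v%:C)) =
   KK * `|x| * \prod_(k' < J) \prod_(1 <= l' < (M k').+1)
      normc (factor L f (a k' l' x) k' x v%:C).
  rewrite -prodt /KK -!big_split; apply: eq_bigr => k' _ /=.
  by rewrite !big_split.
rewrite KtD in le_prod; set PD := \prod_(_ < _) \prod_(_ <= _ < _) normc _ in le_prod *.
have PD0 : 0 <= PD.
  by apply: prodr_ge0 => k' _; apply: prodr_ge0 => l' _; exact: normc_ge0.
have KK0 : 0 <= KK.
  by apply: prodr_ge0 => k' _; apply: prodr_ge0 => l' _; exact: ltW.
apply: le_trans (ler_pM (normc_ge0 _) _ u2v le_prod) _.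
  by apply: prodr_ge0 => k' _; exact: normc_ge0.
rewrite [leLHS](_ : _ = e^-1 * KK / e * `|x| * (e * PD)); last first.
  by field; rewrite gt_eqF.
rewrite ler_wpM2l ?mulr_ge0 ?invr_ge0 ?(ltW e_gt0) //.
by rewrite ler_wpM2r.
Qed.

End Estimates.
End LocalModel.

(** * Pole terms along a branch of the level set *)

Section BranchEstimates.
Variable R : realType.
Local Notation C := R[i].
Implicit Types x : R.
Variables (q q2 : C -> C -> C) (J : nat) (M L : 'I_J -> nat).
Variables (f : 'I_J -> {poly R}) (psi : 'I_J -> nat -> C -> C).
Variables (e : R) (u u2 : C -> C -> C) (a : 'I_J -> nat -> R -> C).
Hypothesis lm : local_model q q2 M L f psi e u u2 a.
Variables (k0 : 'I_J) (l0 : nat).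
Hypothesis l0k : (1 <= l0 <= M k0)%N.

Let e_gt0 : 0 < e. Proof. by have /andP[] := lm_eps lm. Qed.
Let e_le1 : e <= 1. Proof. by have /andP[] := lm_eps lm. Qed.

(** Near 0 the function [psi k0 l0] is real on the real axis, so its real part merely recasts the
    branch as a real-valued function. *)
Definition branch x : R :=
  - (f k0).[x] - x ^+ (2 * L k0) * complex.Re (psi k0 l0 x%:C).

(** Freezing [psi] at 0 changes the gap by [O(x^(2 L k0 + 1))] and leaves the polynomial [H]. Either
    [H] has a nonzero coefficient up to degree [2 * L k0], or it is itself of higher order. *)
Lemma branch_gap_order (k : 'I_J) :
  (exists B d, 0 < d /\ forall x, `|x| < d ->
    `|(f k).[x] - (f k0).[x] - x ^+ (2 * L k0) * complex.Re (psi k0 l0 x%:C)| <=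
    B * `|x| ^+ (2 * L k0).+1) \/
  (exists2 c, 0 < c & forall x, `|x| < c ->
    c * `|x| ^+ (2 * L k0) <= `|branch x + (f k).[x]|).
Proof.
pose N := (2 * L k0)%N.
pose H := f k - f k0 - (complex.Re (psi k0 l0 0)) *: 'X^N.
pose r x := complex.Re (psi k0 l0 x%:C - psi k0 l0 0).
have HE x : (f k).[x] - (f k0).[x] - x ^+ N * complex.Re (psi k0 l0 x%:C) =
    H.[x] - x ^+ N * r x.
  rewrite /H /r !hornerD !hornerN hornerZ hornerXn ReD ReN; ring.
have rP x : `|x| < e -> `|x ^+ N * r x| <= e^-1 * `|x| ^+ N.+1.
  move=> xe; have [_ h _] := lm_psi lm l0k xe.
  rewrite normrM normrX exprSr mulrCA ler_wpM2l ?exprn_ge0 //.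
  exact: le_trans (normc_Re _) h.
have [[i iN Hi]|H0] := pselect (exists2 i, (i <= N)%N & H`_i != 0).
  right; have [c [d [c0 /andP[d0 d1] dP]]] := horner_low_nonzero (ex_intro2 _ _ i iN Hi).
  pose t := Num.min (c / 2) (Num.min d (Num.min e (c / 2 * e))).
  have t0 : 0 < t by rewrite !lt_min !mulr_gt0 ?divr_gt0 // d0 e_gt0.
  exists t => // x; rewrite /t !lt_min -/N => /and4P[_ xd xe xce].
  rewrite /branch (_ : _ + _ = H.[x] - x ^+ N * r x); last by rewrite -HE /N; ring.
  apply: le_trans (_ : c / 2 * `|x| ^+ N <= _).
    by rewrite ler_wpM2r ?exprn_ge0 // ge_min lexx.
  have h1 := dP x xd; have h2 := rP x xe; have h3 := lerB_dist H.[x] (x ^+ N * r x).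
  have h4 : e^-1 * `|x| ^+ N.+1 <= c / 2 * `|x| ^+ N.
    rewrite exprS mulrA ler_wpM2r ?exprn_ge0 // mulrC ler_pdivrMr //.
    exact: ltW.
  have : c * `|x| ^+ N = c / 2 * `|x| ^+ N + c / 2 * `|x| ^+ N by field.
  lra.
left; have [|B B0 BP] := @horner_low_vanish _ H N.
  move=> i iN; apply/eqP/negPn/negP => Hi; apply: H0; by exists i.
exists (B + e^-1), e; split=> // x xe; rewrite HE -/N mulrDl.
apply: le_trans (ler_normB _ _) _; rewrite lerD ?rP // BP //.
by rewrite (le_trans (ltW xe)).
Qed.

(** The bound [e / 2] leaves room for a disc of radius [e / 2] about the branch where the model
    still holds. *)
Lemma branch_small x : `|x| < e ^+ 2 / 4 -> `|branch x| < e / 2.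
Proof.
move=> x4; have e2 : e ^+ 2 <= e by rewrite expr2 ler_piMl ?(ltW e_gt0).
have xe : `|x| < e by move: x4 e2 (sqr_ge0 e); lra.
have x1 : `|x| <= 1 by rewrite (le_trans (ltW xe)).
have [_ _ h] := lm_psi lm l0k xe.
have h1 := lm_f lm k0 xe.
rewrite /branch; apply: le_lt_trans (ler_normB _ _) _; rewrite normrN normrM normrX.
have h2 : `|x| ^+ (2 * L k0) * `|complex.Re (psi k0 l0 x%:C)| <= `|x| * e^-1.
  apply: ler_pM; rewrite ?exprn_ge0 //.
    by rewrite -[leRHS]expr1 ler_wiXn2l // muln_gt0 (lm_L lm).
  exact: le_trans (normc_Re _) h.
apply: le_lt_trans (lerD h1 h2) _.
rewrite [X in X < _](_ : _ = 2 * `|x| / e); last by ring.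
rewrite ltr_pdivrMr //; move: x4; rewrite expr2; lra.
Qed.

Local Notation D k l x := (factor L f (a k l x) k x (branch x)%:C).
Local Notation T k l x := (complex.Im (D k l x) / normc (D k l x) ^+ 2).

Lemma Im_factor_gt0 k l x : x != 0 -> `|x| < e -> 0 < complex.Im (D k l x).
Proof.
move=> x0 xe; apply: lt_le_trans (Im_factor_ge lm k l _ xe).
by rewrite mulr_gt0 ?pow2L_gt0.
Qed.

Lemma pole_term_ge0 k l x : x != 0 -> `|x| < e -> 0 <= T k l x.
Proof.
by move=> x0 xe; rewrite divr_ge0 ?sqr_ge0 // ltW // Im_factor_gt0.
Qed.

(** On the branch its own factor is [y * (a - psi)] with [y = x ^+ (2 * L k0)]: the imaginary part
    is at least [e y] and the modulus at most [2 y / e]. *)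
Lemma pole_term_lower x : x != 0 -> `|x| < e ->
  e ^+ 3 / 4 / x ^+ (2 * L k0) <= T k0 l0 x.
Proof.
move=> x0 xe; have y0 := pow2L_gt0 L k0 x0.
have [a1 a2] := lm_a lm k0 l0 xe; have [_ _ h] := lm_psi lm l0k xe.
have Dle : normc (D k0 l0 x) <= x ^+ (2 * L k0) * (2 * e^-1).
  rewrite (_ : D k0 l0 x = (x ^+ (2 * L k0))%:C *
      (a k0 l0 x - (complex.Re (psi k0 l0 x%:C))%:C)); last first.
    rewrite factor_real /branch.
    rewrite (_ : _ - _ + _ = - (x ^+ (2 * L k0) * complex.Re (psi k0 l0 x%:C))).
      by rewrite rmorphN rmorphM /=; ring.
    by ring.
  rewrite normcM normc_real (gtr0_norm y0) ler_wpM2l ?(ltW y0) //.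
  apply: le_trans (normcB _ _) _; rewrite normc_real.
  have := le_trans (normc_Re _) h; lra.
have Dgt : 0 < normc (D k0 l0 x) by rewrite normc_gt0 // (factor_neq0 lm).
rewrite ler_pdivlMr ?exprn_gt0 //.
apply: le_trans (Im_factor_ge lm k0 l0 _ xe).
apply: le_trans (_ : e ^+ 3 / 4 / x ^+ (2 * L k0) *
    (x ^+ (2 * L k0) * (2 * e^-1)) ^+ 2 <= _).
  rewrite ler_wpM2l ?mulr_ge0 ?invr_ge0 ?(ltW y0) ?exprn_ge0 ?(ltW e_gt0) //.
  by rewrite lerXn2r ?nnegrE ?(ltW Dgt) ?mulr_ge0 ?invr_ge0 ?(ltW y0) ?(ltW e_gt0).
by rewrite le_eqVlt; apply/orP; left; apply/eqP; field; rewrite !gt_eqF.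
Qed.

(** If [L k <= L k0], the term is at most the inverse of the imaginary part. Otherwise the gap keeps
    the modulus above a multiple of [x ^+ (2 * L k0)], and the imaginary part is of smaller
    order. *)
Lemma pole_term_upper k :
  ((L k0 < L k)%N -> exists2 c, 0 < c & forall x, `|x| < c ->
    c * `|x| ^+ (2 * L k0) <= `|branch x + (f k).[x]|) ->
  exists2 d, 0 < d & forall x, x != 0 -> `|x| < d -> forall l,
    T k l x <= d^-1 / x ^+ (2 * L k0).
Proof.
move=> gap; have [Lk|Lk] := leqP (L k) (L k0).
  exists e => // x x0 xe l; have y0 := pow2L_gt0 L k0 x0.
  have I0 := Im_factor_gt0 k l x0 xe.
  have ID : complex.Im (D k l x) <= normc (D k l x).
    exact: le_trans (ler_norm _) (normc_Im _).
  have IE := Im_factor_ge lm k l (branch x) xe.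
  have Yy : x ^+ (2 * L k0) <= x ^+ (2 * L k).
    rewrite !(exprM x 2) ler_wiXn2l ?sqr_ge0 //.
    rewrite -(real_normK (num_real x)) exprn_ile1 //.
    by rewrite (le_trans (ltW xe)).
  apply: le_trans (_ : (complex.Im (D k l x))^-1 <= _).
    rewrite ler_pdivrMr ?exprn_gt0 ?(lt_le_trans I0) //.
    rewrite mulrC ler_pdivlMr // -expr2 lerXn2r ?nnegrE ?(ltW I0) //.
    exact: le_trans (ltW I0) ID.
  rewrite -invfM lef_pV2 ?posrE ?mulr_gt0 //.
  apply: le_trans IE; rewrite mulrC.
  by rewrite mulrC ler_wpM2l ?(ltW e_gt0).
have [c c0 cP] := gap Lk.
(* The entry [c * e / 2] makes the term with [a] at most half of the gap, which yields [c / 2] in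
   [Dge]; the last entry makes [d^-1] an upper constant. *)
pose d := Num.min e (Num.min c (Num.min (c * e / 2) (4 * (e^-1 / c ^+ 2))^-1)).
have d0 : 0 < d.
  by rewrite !lt_min e_gt0 c0 !invr_gt0 !mulr_gt0 ?invr_gt0 ?exprn_gt0.
exists d => // x x0 + l; rewrite {1}/d !lt_min => /and4P[xe xc xce _].
have y0 := pow2L_gt0 L k0 x0; have Y0 := pow2L_gt0 L k x0.
have x1 : `|x| <= 1 by rewrite (le_trans (ltW xe)).
have nE k' : `|x| ^+ (2 * L k') = x ^+ (2 * L k').
  by rewrite !(exprM _ 2) real_normK ?num_real.
have gapx := cP x xc; rewrite nE in gapx.
have Yy : x ^+ (2 * L k) <= x ^+ (2 * L k0) * `|x|.
  rewrite -!nE -exprSr ler_wiXn2l // mul2n mul2n ltn_double //.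
have Yy' : x ^+ (2 * L k) <= x ^+ (2 * L k0).
  by apply: le_trans Yy _; rewrite ler_piMr ?(ltW y0).
have [_ a2] := lm_a lm k l xe.
have I0 := Im_factor_gt0 k l x0 xe.
have Ya : normc ((x ^+ (2 * L k))%:C * a k l x) <= x ^+ (2 * L k) * e^-1.
  by rewrite normcM normc_real (gtr0_norm Y0) ler_wpM2l // ltW.
have Dge : c / 2 * x ^+ (2 * L k0) <= normc (D k l x).
  have := normcB (D k l x) ((x ^+ (2 * L k))%:C * a k l x).
  rewrite {1}factor_real addrK normc_real => h.
  have : x ^+ (2 * L k) * e^-1 <= c / 2 * x ^+ (2 * L k0).
    rewrite ler_pdivrMr //; apply: le_trans Yy _; rewrite mulrC mulrAC.
    rewrite ler_wpM2r ?(ltW y0) //; move: xce; lra.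
  have : c * x ^+ (2 * L k0) = c / 2 * x ^+ (2 * L k0) + c / 2 * x ^+ (2 * L k0).
    by field.
  lra.
have cy : 0 < c / 2 * x ^+ (2 * L k0) by rewrite mulr_gt0 ?divr_gt0.
have ImD : complex.Im (D k l x) <= x ^+ (2 * L k0) * e^-1.
  rewrite Im_factor; apply: ler_pM; rewrite ?(ltW Y0) //.
    by have [h _] := lm_a lm k l xe; rewrite (le_trans _ h) // ltW.
  by apply: le_trans a2; exact: le_trans (ler_norm _) (normc_Im _).
apply: le_trans (_ : (4 * (e^-1 / c ^+ 2)) / x ^+ (2 * L k0) <= _).
  rewrite ler_pdivrMr ?exprn_gt0 ?(lt_le_trans cy) //.
  apply: le_trans ImD _.
  apply: le_trans (_ : 4 * (e^-1 / c ^+ 2) / x ^+ (2 * L k0) *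
     (c / 2 * x ^+ (2 * L k0)) ^+ 2 <= _).
    by rewrite le_eqVlt; apply/orP; left; apply/eqP; field; rewrite !gt_eqF.
  rewrite ler_wpM2l //.
    by rewrite !mulr_ge0 ?invr_ge0 ?(ltW y0) ?exprn_ge0 ?(ltW e_gt0) ?(ltW c0).
  by rewrite lerXn2r ?nnegrE ?(ltW cy) // (le_trans (ltW cy)).
rewrite ler_wpM2r ?invr_ge0 ?(ltW y0) //.
rewrite -[leLHS]invrK lef_pV2 ?posrE //.
  by rewrite /d !ge_min lexx !orbT.
by rewrite !(invr_gt0, mulr_gt0) ?exprn_gt0.
Qed.

Hypothesis gap : forall k, (L k0 < L k)%N -> exists2 c, 0 < c & forall x, `|x| < c ->
    c * `|x| ^+ (2 * L k0) <= `|branch x + (f k).[x]|.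

(** All terms are nonnegative, so nothing cancels and the term [(k0, l0)] alone gives the lower
    bound. *)
Lemma sum_pole_terms_bounds : exists c B d : R, [/\ 0 < c, 0 < B, 0 < d &
  forall x, x != 0 -> `|x| < d ->
  c / x ^+ (2 * L k0) <=
    \sum_(k < J) \sum_(1 <= l < (M k).+1) T k l x <= B / x ^+ (2 * L k0)].
Proof.
have [d /andP[d0 d1] dP] : exists2 d, 0 < d <= 1 & forall k x, x != 0 -> `|x| < d ->
    forall l, T k l x <= d^-1 / x ^+ (2 * L k0).
  apply: uniform_eps => [k|k d d' d'0 d'd dP x x0 xd' l].
    by apply: pole_term_upper => /gap.
  apply: le_trans (dP x x0 (lt_le_trans xd' d'd) l) _.
  rewrite ler_wpM2r ?invr_ge0 ?(ltW (pow2L_gt0 L k0 x0)) //.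
  by rewrite lef_pV2 ?posrE // (lt_le_trans d'0).
exists (e ^+ 3 / 4), (\sum_(k < J) \sum_(1 <= l < (M k).+1) d^-1 + 1), (Num.min d e).
split.
- by rewrite divr_gt0 ?exprn_gt0.
- rewrite ltr_wpDl // sumr_ge0 // => k _.
  by rewrite sumr_ge0 // => l _; rewrite invr_ge0 ltW.
- by rewrite lt_min d0.
move=> x x0; rewrite lt_min => /andP[xd xe]; apply/andP; split.
  apply: le_trans (pole_term_lower x0 xe) _.
  rewrite (bigD1 k0) //= (bigD1_seq l0) ?mem_index_iota ?iota_uniq //=.
  rewrite -addrA lerDl addr_ge0 ?sumr_ge0 // => k _; first exact: pole_term_ge0.
  by rewrite sumr_ge0 // => l _; exact: pole_term_ge0.
rewrite mulrDl ler_wpDr //; first by rewrite mul1r invr_ge0 ltW // pow2L_gt0.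
rewrite mulr_suml; apply: ler_sum => k _; rewrite mulr_suml.
by apply: ler_sum => l _; exact: dP.
Qed.

(** [Q] is to be the slice of [q] at a fixed [x]. Agreement is asked only for [normc h < 1], which
    avoids the pole [-i] of [cayley_inv]. *)
Lemma log_deriv_bounds : exists c B d : R, [/\ 0 < c, 0 < B, 0 < d &
  forall x (Q : {poly C}), x != 0 -> `|x| < d ->
  (forall h, normc h < 1 ->
     Q.[(branch x)%:C + h] = q x%:C ((branch x)%:C + h)) ->
  [/\ `|branch x| < 1, Q.[(branch x)%:C] != 0 &
  c / x ^+ (2 * L k0) <=
    `|complex.Im ((Q^`()%R).[(branch x)%:C] / Q.[(branch x)%:C])|
     <= B / x ^+ (2 * L k0)]].
Proof.
have [c [B [d [c0 B0 d0 sumP]]]] := sum_pole_terms_bounds.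
pose Lam := e^-1 / e; have Lam0 : 0 < Lam by rewrite divr_gt0 ?invr_gt0.
have L2 : 0 < 2 * Lam by rewrite pmulr_rgt0.
(* The last entry makes the error [Lam] caused by [u] at most half of the lower bound for the
   sum. *)
pose s := Num.min d (Num.min (e ^+ 2 / 4) (Num.min 1 (c / (2 * Lam)))).
have s0 : 0 < s.
  by rewrite !lt_min d0 ltr01 (divr_gt0 c0 L2) divr_gt0 ?exprn_gt0.
exists (c / 2), (B + Lam), s; split=> //; [by rewrite divr_gt0|by rewrite addr_gt0|].
move=> x Q x0; rewrite /s !lt_min => /and4P[xd x4 x1 xc] QP.
have bx := branch_small x4; set v := branch x in bx QP *.
have e2 : e ^+ 2 <= e by rewrite expr2 ler_piMl ?(ltW e_gt0).
have xe : `|x| < e by move: x4 e2 (sqr_ge0 e); lra.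
have y0 := pow2L_gt0 L k0 x0.
have nv : normc v%:C < e / 2 by rewrite normc_real.
have ve : normc v%:C < e by move: nv e_gt0; lra.
have vhe h : normc h < e / 2 -> normc (v%:C + h) < e.
  by move=> he; apply: le_lt_trans (le_normcD _ _) _; lra.
pose b k l : C := ((f k).[x])%:C + (x ^+ (2 * L k))%:C * a k l x.
pose P : {poly C} := \prod_(k < J) \prod_(1 <= l < (M k).+1) ('X + (b k l)%:P).
have PE w : P.[w] = \prod_(k < J) \prod_(1 <= l < (M k).+1) factor L f (a k l x) k x w.
  rewrite horner_prod; apply: eq_bigr => k _; rewrite horner_prod.
  by apply: eq_bigr => l _; rewrite hornerD hornerX hornerC /factor /b addrA.
have fv k l : ('X + (b k l)%:P).[v%:C] = D k l x.
  by rewrite hornerD hornerX hornerC /factor /b addrA.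
have fv0 k l : ('X + (b k l)%:P).[v%:C] != 0 by rewrite fv (factor_neq0 lm).
have fvk0 k : (\prod_(1 <= l < (M k).+1) ('X + (b k l)%:P)).[v%:C] != 0.
  by rewrite horner_prod prodf_seq_neq0; apply/allP => l _; exact: fv0.
have Pv : P.[v%:C] != 0.
  by rewrite horner_prod prodf_seq_neq0; apply/allP => k _; exact: fvk0.
have uv := lm_u lm xe ve.
have uv0 : u x%:C v%:C != 0 by rewrite -normc_eq0 gt_eqF // (lt_le_trans e_gt0).
have QuP h : normc h < e / 2 -> Q.[v%:C + h] = u x%:C (v%:C + h) * P.[v%:C + h].
  move=> he; rewrite QP; last by move: he e_le1 e_gt0; lra.
  by rewrite (lm_q lm) // ?PE // vhe.
have [e2_0 ie0] : 0 < e / 2 /\ 0 <= e^-1 by rewrite divr_gt0 // invr_ge0 ltW.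
have := log_deriv_lipschitz_factor ie0 e2_0 e_gt0 uv Pv QuP.
have uLip h : normc h < e / 2 ->
    normc (u x%:C (v%:C + h) - u x%:C v%:C) <= e^-1 * normc h.
  move=> he; have := lm_u_lip lm xe (vhe h he) ve.
  by rewrite (_ : v%:C + h - v%:C = h) //; ring.
move=> /(_ uLip); rewrite -/Lam => hQP.
have ImP : complex.Im ((P^`()%R).[v%:C] / P.[v%:C]) =
    - \sum_(k < J) \sum_(1 <= l < (M k).+1) T k l x.
  rewrite log_deriv_prod // (big_morph (@complex.Im R) (@ImD R) (erefl _)).
  rewrite -sumrN; apply: eq_bigr => k _; rewrite log_deriv_prod //.
  rewrite (big_morph (@complex.Im R) (@ImD R) (erefl _)) -sumrN.
  apply: eq_bigr => l _; rewrite derivD derivX derivC addr0 hornerC mul1r.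
  by rewrite Im_inv fv.
have /andP[S1 S2] := sumP x x0 xd.
have := le_trans (normc_Im _) hQP; rewrite ImD ImN ImP opprK.
set S := \sum_(_ < _) _ in S1 S2 *; set I := complex.Im _ => hI.
have y1 : x ^+ (2 * L k0) <= `|x|.
  rewrite (_ : x ^+ _ = `|x| ^+ (2 * L k0)); last first.
    by rewrite !(exprM _ 2) real_normK ?num_real.
  by rewrite -[leRHS]expr1 ler_wiXn2l ?(ltW x1) // muln_gt0 (lm_L lm).
have cL : Lam <= c / 2 / x ^+ (2 * L k0).
  rewrite ler_pdivlMr //; apply: le_trans (_ : Lam * `|x| <= _).
    by rewrite ler_wpM2l // ltW.
  move: (ltW xc); rewrite ler_pdivlMr // mulrCA (mulrC _ Lam).
  set t := Lam * _; lra.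
have LB : Lam <= Lam / x ^+ (2 * L k0).
  by rewrite ler_pdivlMr // (ler_piMr (ltW Lam0)) // (le_trans y1 (ltW x1)).
split.
- by move: bx e_le1; lra.
- have := QuP 0; rewrite normc0 !addr0 => -> //; exact: mulf_neq0.
have cE : c / x ^+ (2 * L k0) = c / 2 / x ^+ (2 * L k0) + c / 2 / x ^+ (2 * L k0).
  by field; rewrite gt_eqF.
have S0 : 0 <= S by apply: le_trans S1; rewrite divr_ge0 // ltW.
move: hI; rewrite ler_norml => /andP[hI1 hI2]; apply/andP; split.
  by rewrite -normrN; apply: le_trans (ler_norm _); lra.
by rewrite mulrDl ler_norml; apply/andP; split; lra.
Qed.

End BranchEstimates.

(** * The estimate of the weight *)

Section Cayley.
Variable R : realType.
Local Notation C := R[i].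

Lemma cayleyK (s : C) : 1 + s != 0 -> cayley_inv (cayley s) = s.
Proof.
move=> s1; rewrite /cayley_inv /cayley.
have -> : 'i * ('i * (1 - s) / (1 + s)) = - ((1 - s) / (1 + s)) :> C.
  by rewrite !mulrA -expr2 sqrCi mulN1r mulNr.
have -> : 1 + - ((1 - s) / (1 + s)) = 2 * s / (1 + s) by field.
have -> : 1 - - ((1 - s) / (1 + s)) = 2 / (1 + s) by field.
by field.
Qed.

(** The distance equals [2 |x| / |1 - i x|], with a denominator between 1 and 2. *)
Lemma normc_cayley_invB1 (x : R) : `|x| <= 1 ->
  `|x| <= normc (cayley_inv x%:C - 1) <= 2 * `|x|.
Proof.
move=> x1; have x0 := oneB_iM_neq0 x.
have -> : cayley_inv x%:C - 1 = 2 * 'i * x%:C / (1 - 'i * x%:C).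
  by rewrite /cayley_inv; field.
have ni : normc ('i : C) = 1 by apply: (@complexI R); rewrite -normrE normCi.
have n2 : normc (2 : C) = 2.
  by apply: (@complexI R); rewrite -normrE normr_nat rmorph_nat.
rewrite !normcM normcV n2 ni mulr1 normc_real.
have d1 : 1 <= normc (1 - 'i * x%:C).
  apply: le_trans (normc_Re _); rewrite -mulrN -rmorphN Re_oneD_iM normr1 //.
have d2 : normc (1 - 'i * x%:C) <= 2.
  by apply: le_trans (normcB _ _) _; rewrite normc1 normcM ni mul1r normc_real; lra.
have d0 : 0 < normc (1 - 'i * x%:C) by rewrite (lt_le_trans _ d1).
rewrite ler_pdivlMr // ler_pdivrMr //; apply/andP; split.
  by rewrite mulrC ler_wpM2r.
by rewrite ler_peMr ?mulr_ge0.
Qed.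

Lemma circle_cayley (t : C) : `|t| = 1 -> normc (t - 1) < 1 ->
  exists x : R, [/\ t = cayley_inv x%:C, `|x| <= normc (t - 1) &
                    (t != 1 -> x != 0)].
Proof.
move=> t1 tn; have t0 : t != 0 by rewrite -normr_eq0 t1 oner_eq0.
have n2 : normc (2 : C) = 2.
  by apply: (@complexI R); rewrite -normrE normr_nat rmorph_nat.
have tp : 1 < normc (1 + t).
  have := normcB (1 + t) (t - 1).
  have -> : 1 + t - (t - 1) = 2 by ring.
  rewrite n2; lra.
have t1n : 1 + t != 0 by rewrite -normc_eq0 gt_eqF // (lt_trans _ tp).
have /complex_realP[x xE] : cayley t \is Num.real.
  apply/CrealP; rewrite /cayley rmorphM rmorphM fmorphV /= rmorphB rmorphD /=.
  rewrite !rmorph1 conjCi (conj_unit t1); field.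
  by rewrite t1n t0.
exists x; rewrite -xE cayleyK //; split=> //.
  rewrite -normc_real -xE /cayley !normcM normcV normcC.
  have -> : normc ('i : C) = 1 by apply: (@complexI R); rewrite -normrE normCi.
  by rewrite mul1r ler_pdivrMr ?(lt_trans _ tp) // ler_peMr ?normc_ge0 ?ltW.
apply: contra_neq => x0; have := cayleyK t1n; rewrite xE x0 => <-.
by rewrite /cayley_inv rmorph0 mulr0 addr0 subr0 divr1.
Qed.

End Cayley.

Section WeightEstimate.
Variable R : realType.
Local Notation C := R[i].
Variables (m n : nat) (p : {poly {poly C}}).
Hypothesis hp : rif_denominator m n p.

Lemma weight_branch_bounds (tau gamma alpha : C)
    (J : nat) (M L : 'I_J -> nat) (f : 'I_J -> {poly R})
    (psi : 'I_J -> nat -> C -> C) (k0 : 'I_J) (l0 : nat) :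
  `|tau| = 1 -> `|gamma| = 1 ->
  local_factorization (halfplane m n p tau gamma) M L f ->
  level_factorization (fun z1 z2 =>
    halfplane m n (rif_reflect m n p) tau gamma z1 z2
    - alpha * halfplane m n p tau gamma z1 z2) M L f psi ->
  (1 <= l0 <= M k0)%N ->
  (forall k, ~ curve_value (halfplane m n p tau gamma)
     (halfplane m n (rif_reflect m n p) tau gamma) (f k) alpha) ->
  exists c B d : R, [/\ 0 < c, 0 < B, 0 < d & forall x : R, x != 0 -> `|x| < d ->
    c * x ^+ (2 * L k0) <=
    (normc (derive1 (fun z2 => rif m n p (tau * cayley_inv x%:C) z2)
      (gamma * cayley_inv (- evalR (f k0) x%:C -
                           x%:C ^+ (2 * L k0) * psi k0 l0 x%:C))))^-1
    <= B * x ^+ (2 * L k0)].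
Proof.
move=> t1 g1 qf q2f lk nocv.
have [e [u [u2 [a lm]]]] := local_modelP qf q2f.
have /andP[e0 e1] := lm_eps lm.
(* In the other case of the dichotomy [alpha] would be the value along the curve of [f k], which is
   excluded. *)
have gap k : (L k0 < L k)%N -> exists2 c, 0 < c & forall x, `|x| < c ->
    c * `|x| ^+ (2 * L k0) <= `|branch L f psi k0 l0 x + (f k).[x]|.
  move=> _; have [/(agreeing_curve_value lm lk)|//] := branch_gap_order lm lk k.
  by move/nocv.
have [c [B [d [c0 B0 d0 hP]]]] := log_deriv_bounds lm lk gap.
(* Inversion exchanges the two bounds; the 2 accounts for [1 <= 1 + v ^+ 2 <= 2]. *)
exists (2 * B)^-1, c^-1, (Num.min d e); split.
- by rewrite invr_gt0 mulr_gt0.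
- by rewrite invr_gt0.
- by rewrite lt_min d0.
move=> x x0; rewrite lt_min => /andP[xd xe].
have [pr _ _] := lm_psi lm lk xe.
set v := branch L f psi k0 l0 x.
have -> : - evalR (f k0) x%:C - x%:C ^+ (2 * L k0) * psi k0 l0 x%:C = v%:C.
  rewrite evalR_real -(RRe_real pr) /v /branch rmorphB rmorphN rmorphM.
  by rewrite rmorphXn.
set z := tau * _.
have z1 : `|z| = 1 by rewrite normrM t1 mul1r norm_cayley_inv.
have pm : (size p <= m.+1)%N by rewrite (rif_deg1 hp).
have pn := size_coef_den hp.
have rn : (size (p.[z%:P])%R <= n.+1)%N by exact: size_horner_outer.
pose Q0 := halfplane_poly n p.[z%:P] gamma.
(* This factor of [halfplane] is constant in the second variable and cancels in the logarithmic
   derivative. *)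
pose k : C := (1 - 'i * x%:C) ^+ m.
have k_neq0 : k != 0 by rewrite expf_neq0 ?oneB_iM_neq0.
have [|v1 Qv /andP[I1 I2]] := hP x (k *: Q0) x0 xd.
  move=> h h1; rewrite hornerZ halfplane_polyE //; first by rewrite mulrA.
  (* For real [v] the real part of [1 - i (v + h)] is [1 + Im h], hence positive. *)
  apply/eqP => /(congr1 (@complex.Re R)); rewrite -/v mulrDr opprD addrA.
  rewrite ReD -mulrN -rmorphN Re_oneD_iM ReN Re_iM opprK => hh.
  have := le_lt_trans (normc_Im h) h1; rewrite ltr_norml => /andP[+ _].
  by move: hh => /=; lra.
rewrite -/v in v1 Qv I1 I2.
have Q0v : Q0.[v%:C] != 0 by move: Qv; rewrite hornerZ mulf_eq0 negb_or => /andP[].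
have E : ((k *: Q0)^`()%R).[v%:C] / (k *: Q0).[v%:C] = (Q0^`()%R).[v%:C] / Q0.[v%:C].
  by rewrite derivZ !hornerZ; field; rewrite k_neq0 Q0v.
rewrite E in I1 I2.
rewrite (normc_deriv_rif_halfplane pm pn z1 g1 Q0v) -/Q0.
set I := `|_| in I1 I2 *.
have y0 := pow2L_gt0 L k0 x0.
have I0 : 0 < I by apply: lt_le_trans I1; rewrite divr_gt0.
have v2 : v ^+ 2 <= 1 by rewrite -(real_normK (num_real v)) exprn_ile1 // ltW.
have v20 : 0 <= v ^+ 2 by exact: sqr_ge0.
have v3 : 0 < 1 + v ^+ 2 by lra.
have vI : 0 < (1 + v ^+ 2) * I by rewrite mulr_gt0.
rewrite ler_pdivlMr // in I2; rewrite ler_pdivrMr // in I1.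
apply/andP; split.
  rewrite mulrC ler_pdivrMr ?mulr_gt0 // mulrC ler_pdivlMr //.
  apply: le_trans (_ : 2 * (I * x ^+ (2 * L k0)) <= _).
    rewrite [leLHS](_ : _ = (1 + v ^+ 2) * (I * x ^+ (2 * L k0))); last by ring.
    by rewrite ler_wpM2r ?mulr_ge0 ?(ltW I0) ?(ltW y0) //; lra.
  by rewrite ler_wpM2l.
rewrite -[leRHS]invrK lef_pV2 ?posrE ?invr_gt0 ?mulr_gt0 ?invr_gt0 //.
rewrite invfM invrK ler_pdivrMr //; apply: le_trans I1 _.
rewrite ler_wpM2r ?(ltW y0) //; rewrite ler_peMl ?(ltW I0) //; lra.
Qed.

Definition exceptional_values : set C :=
  \bigcup_(t in [set t : C * C | singularity m n p t.1 t.2])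
  \bigcup_(g in [set g : {poly R} | exists J (M L : 'I_J -> nat) f k,
      local_factorization (halfplane m n p t.1 t.2) M L f /\ f k = g])
  [set alpha | curve_value (halfplane m n p t.1 t.2)
     (halfplane m n (rif_reflect m n p) t.1 t.2) g alpha].

Lemma finite_exceptional_values : finite_set exceptional_values.
Proof.
apply: bigcup_finite => [|t _]; first exact: finite_singularities.
apply: bigcup_finite => [|g _].
  have [[J [M [L [f qf]]]]|no] := pselect (exists J (M L : 'I_J -> nat) f,
      local_factorization (halfplane m n p t.1 t.2) M L f).
    apply: sub_finite_set (finite_image f (@finite_finset _ setT)).
    move=> _ [J' [M' [L' [f' [k [qf' <-]]]]]].
    have [k' ->] := local_factorization_unique qf' qf k.
    by exists k'.
  apply: sub_finite_set (finite_set0 _) => g' /= [J [M [L [f [k [qf _]]]]]].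
  by apply: no; exists J, M, L, f.
have [[b bP]|no] := pselect (exists b, curve_value (halfplane m n p t.1 t.2)
     (halfplane m n (rif_reflect m n p) t.1 t.2) g b).
  apply: sub_finite_set (finite_set1 b) => b' /= b'P.
  exact: curve_value_unique b'P bP.
by apply: sub_finite_set (finite_set0 _) => b bP; apply: no; exists b.
Qed.

End WeightEstimate.

Theorem theorem5p6 (R : realType) (m n : nat) (p : {poly {poly R[i]}})
    (hm : (0 < m)%N) (hn : (0 < n)%N) (hp : rif_denominator m n p) :
  exists E : seq R[i], forall alpha : R[i],
    generic m n p alpha -> alpha \notin E ->
    forall (tau0 : R[i]) (g : 'I_n -> R[i] -> R[i]),
      level_parametrization m p alpha tau0 g ->
    forall (tau gamma : R[i]) (j : 'I_n),
      singularity m n p tau gamma -> g j tau = gamma ->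
    forall K : nat, contact_order m n p alpha tau gamma (g j) K ->
    exists c C : R, 0 < c /\
      \forall zeta \near tau, `|zeta| = 1 -> zeta <> tau ->
        c%:C <= weight m n p (g j) zeta / `|zeta - tau| ^+ K <= C%:C.
Proof.
have /finite_seqP[E EP] := finite_exceptional_values hp.
exists E => alpha _ aE tau0 g lp tau gamma j sing gtau K.
move=> [J [M [L [f [psi [qf q2f [k0 [l0 [lk hnear ->]]]]]]]]].
have [t1 g1 _ _] := sing.
have nocv k : ~ curve_value (halfplane m n p tau gamma)
    (halfplane m n (rif_reflect m n p) tau gamma) (f k) alpha.
  move=> cv; move: aE; apply/negP/negPn.
  suff : [set` E] alpha by [].
  by rewrite -EP; exists (tau, gamma) => //; exists (f k) => //; exists J, M, L, f, k.
have [c [B [d [c0 B0 d0 W]]]] := weight_branch_bounds hp t1 g1 qf q2f lk nocv.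
have t0 : tau != 0 by rewrite -normr_eq0 t1 oner_eq0.
have g0 : gamma != 0 by rewrite -normr_eq0 g1 oner_eq0.
have [r1 r10 r1P] := (near_real0 _).1 hnear.
(* Away from the base point [g j] is analytic, so it obeys a Lipschitz bound at [tau]. The radius
   [A^-1] then keeps [g j z] within distance 1 of [gamma], where the Cayley map is invertible. *)
have tau0E : tau <> tau0 by move/esym; exact: (level_base_regular lp sing).
have [G Gan /near_cplx[r3 r30 Gz]] := level_analytic lp j t1 tau0E.
have [r2 [A [r20 A0 GL]]] := analytic_lipschitz Gan.
have Gtau : G tau = gamma by rewrite -gtau Gz // subrr normc0.
pose r := Num.min (Num.min r1 d) (Num.min (Num.min r2 r3) (Num.min 1 A^-1)).
have r0 : 0 < r by rewrite !lt_min r10 d0 r20 r30 ltr01 invr_gt0.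
have nV (b : R[i]) : `|b| = 1 -> normc b^-1 = 1.
  move=> b1; rewrite normcV; apply/eqP; rewrite invr_eq1; apply/eqP.
  by apply: (@complexI R); rewrite -normrE.
(* The power of 2 comes from [|z - tau| <= 2 |x|]; the upper bound uses [|x| <= |z - tau|]. *)
exists (c / 2 ^+ (2 * L k0)), B; split; first by rewrite divr_gt0 ?exprn_gt0.
apply/near_cplx; exists r => // z; rewrite !lt_min -!andbA.
move=> /and5P[zr1 zd zr2 zr3 /andP[zr4 zA]] z1 zt.
have tn : normc (tau^-1 * z - 1) = normc (z - tau).
  by rewrite -[1](mulVf t0) -mulrBr normcM nV // mul1r.
have [||x [tE xle x0]] := @circle_cayley R (tau^-1 * z).
- by rewrite normrM normrV ?unitfE // t1 z1 invr1 mulr1.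
- by rewrite tn.
have {}x0 : x != 0.
  apply: x0; apply/eqP => e1; apply: zt.
  by rewrite -[z](mulVKf t0) e1 mulr1.
rewrite tn in xle.
have zE : z = tau * cayley_inv x%:C by rewrite -tE mulVKf.
have x1 : `|x| <= 1 by rewrite (le_trans xle) // ltW.
have hx := r1P x (le_lt_trans xle zr1); rewrite -zE (conj_unit g1) in hx.
have sn : normc (gamma^-1 * g j z - 1) < 1.
  rewrite -[1 in X in normc X](mulVf g0) -mulrBr normcM nV // mul1r Gz // -Gtau.
  apply: le_lt_trans (GL z zr2) _.
  by rewrite mulrC -ltr_pdivlMr // mul1r.
(* The junk value [cayley (-1) = 0] is excluded by the continuity of [g j]. *)
have s1 : 1 + gamma^-1 * g j z != 0.
  apply: contraTneq sn; rewrite addrC => /eqP; rewrite addr_eq0 => /eqP ->.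
  rewrite -leNgt -opprD normcN.
  have -> : normc (1 + 1 : R[i]) = 2.
    by rewrite -(rmorphD (real_complex R) 1 1) normc_real ger0_norm //; lra.
  lra.
have gE : g j z = gamma * cayley_inv (- evalR (f k0) x%:C -
    x%:C ^+ (2 * L k0) * psi k0 l0 x%:C).
  by rewrite -hx cayleyK // mulVKf.
have /andP[W1 W2] := W x x0 (le_lt_trans xle zd).
rewrite -gE -zE in W1 W2; set X := (normc _)^-1 in W1 W2.
have -> : weight m n p (g j) z / `|z - tau| ^+ (2 * L k0) =
    (X / normc (z - tau) ^+ (2 * L k0))%:C.
  by rewrite rmorphM !fmorphV rmorphXn.
rewrite !lecR.
have /andP[N1 N2] := normc_cayley_invB1 x1; rewrite -tE tn in N1 N2.
have yE : x ^+ (2 * L k0) = `|x| ^+ (2 * L k0).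
  by rewrite !(exprM _ 2) real_normK ?num_real.
rewrite yE in W1 W2; set N := normc _ in N1 N2 *.
have N0 : 0 < N by rewrite (lt_le_trans _ N1) ?normr_gt0.
have NK0 : 0 < N ^+ (2 * L k0) by rewrite exprn_gt0.
rewrite ler_pdivlMr // ler_pdivrMr //; apply/andP; split.
  apply: le_trans W1.
  rewrite mulrAC ler_pdivrMr ?exprn_gt0 // -mulrA ler_pM2l // -exprMn mulrC.
  by rewrite lerXn2r ?nnegrE ?mulr_ge0 ?(ltW N0) // mulrC.
apply: le_trans W2 _; rewrite ler_pM2l // lerXn2r ?nnegrE ?(ltW N0) //.
Qed.
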